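(* Let $d\ge2$ be an integer and let $p,n$ be real numbers with $p\ge n>d/2+1$. Let $v\in\mathbb H^{p}$ and $w\in\mathbb H^{p+1}$ (so that $\mathcal P(v,w)\in\mathbb H^p$). Then $$|\langle\mathcal P(v,w)|w\rangle_p|\le\tfrac12 G^{+}_{pn}\big(\|v\|_p\|w\|_n+\|v\|_n\|w\|_p\big)\|w\|_p,$$ where $$G^{+}_{pn}:=\frac1{(2\pi)^{d/2}}\sqrt{\sup_{k\in\mathbf Z^d_0}\mathcal G_{pn}(k)},\qquad \mathcal G_{pn}(k):=4\sum_{h\in\mathbf Z^d_{0k}}\frac{(|k|^p-|k-h|^p)^2\,|P_{h,k-h}|^2}{\big(|h|^p|k-h|^{n-1}+|h|^n|k-h|^{p-1}\big)^2}.$$ Therefore there are constants $G\ge0$ such that $|\langle\mathcal P(v,w)|w\rangle_p|\le\frac12G(\|v\|_p\|w\|_n+\|v\|_n\|w\|_p)\|w\|_p$ for all $v\in\mathbb H^p$, $w\in\mathbb H^{p+1}$, and the smallest such constant $G_{pn}$ satisfies $G_{pn}\le G^{+}_{pn}$.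
   Context: Notation. $\mathbf T^d=(\mathbf R/2\pi\mathbf Z)^d$; $e_k(x)=(2\pi)^{-d/2}e^{ik\cdot x}$ for $k\in\mathbf Z^d$. For $a,b\in\mathbf C^d$: $a\cdot b=\sum_r a_rb_r$ (no conjugation), $|a|=\sqrt{\overline a\cdot a}$. $\mathbf Z^d_0=\mathbf Z^d\setminus\{0\}$, $\mathbf Z^d_{0k}=\mathbf Z^d\setminus\{0,k\}$. Every $\mathbf R^d$-valued distribution $v$ on $\mathbf T^d$ has a Fourier expansion $v=\sum_{k}v_ke_k$ with $v_k=\overline{v_{-k}}\in\mathbf C^d$. For real $m$, $\mathbb H^m$ is the Sobolev space of $\mathbf R^d$-valued distributions $v$ on $\mathbf T^d$ with zero divergence and zero mean ($k\cdot v_k=0$ for all $k$, $v_0=0$) and $\sum_{k\in\mathbf Z^d_0}|k|^{2m}|v_k|^2<\infty$, with inner product $\langle v|w\rangle_m=\sum_{k\in\mathbf Z^d_0}|k|^{2m}\overline{v_k}\cdot w_k$ and norm $\|v\|_m=\sqrt{\langle v|v\rangle_m}$. For $k\in\mathbf R^d$, $k^\perp=\{a\in\mathbf C^d: k\cdot a=0\}$ and $\mathfrak L_k:\mathbf C^d\to k^\perp$ is the orthogonal projection ($\mathfrak L_kc=c-\frac{k\cdot c}{|k|^2}k$ for $k\neq0$, $\mathfrak L_0c=c$). The Leray projection $\mathfrak L$ acts by $(\mathfrak Lv)_k=\mathfrak L_kv_k$. The Navier-Stokes bilinear map is $\mathcal P(v,w)=\mathfrak L(v\cdot\partial w)$,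 with $(v\cdot\partial w)_s=\sum_{r=1}^dv_r\partial_rw_s$; it maps $\mathbb H^p\times\mathbb H^{p+1}$ to $\mathbb H^p$ for $p>d/2$. For $h,\ell\in\mathbf Z^d_0$, $P_{h\ell}:h^\perp\times\ell^\perp\to(h+\ell)^\perp$ is the bilinear map $P_{h\ell}(a,b)=\frac{a\cdot\ell}{|\ell|}\,\mathfrak L_{h+\ell}b$, and $|P_{h\ell}|=\min\{Q\ge0:\ |P_{h\ell}(a,b)|\le Q|a||b|\ \text{for all } a\in h^\perp,b\in\ell^\perp\}$. The sums defining $\mathcal G_{pn}(k)$ are finite and $\mathcal G_{pn}$ is bounded on $\mathbf Z^d_0$. *)

(* Defs.v *)
From HB Require Import structures.
From mathcomp Require Import all_boot all_order all_algebra.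
From mathcomp Require Import all_classical all_reals all_analysis.
From mathcomp Require Export complex.

Set Implicit Arguments.
Unset Strict Implicit.
Unset Printing Implicit Defensive.

Import Order.TTheory GRing.Theory Num.Theory.
Import numFieldNormedType.Exports.

Local Open Scope classical_set_scope.
Local Open Scope ring_scope.
Local Open Scope complex_scope.

Section Sums.
Context {R : realType} {T : choiceType}.

(* Sum of an absolutely summable family; a junk value otherwise. *)
Definition rsum (S : set T) (f : T -> R) : R :=
  fine (\esum_(i in S) (EFin \o f)^\+%E i - \esum_(i in S) (EFin \o f)^\-%E i)%E.

Definition csum (S : set T) (f : T -> R[i]) : R[i] :=
  rsum S (fun i => complex.Re (f i)) +i* rsum S (fun i => complex.Im (f i)).

End Sums.

Section ComplexVectors.
Context {R : realType} {d : nat}.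

(* No conjugation. *)
Definition dot (a b : 'rV[R[i]]_d) : R[i] := \sum_(r < d) a 0 r * b 0 r.

Definition conjv (a : 'rV[R[i]]_d) : 'rV[R[i]]_d := \row_r (a 0 r)^*.

Definition cnorm (a : 'rV[R[i]]_d) : R := Num.sqrt (complex.Re (dot (conjv a) a)).

End ComplexVectors.

Section Lattice.
Context {R : realType} {d : nat}.

Definition Z0 : set 'rV[int]_d := [set k | k <> 0].

Definition Z0k (k : 'rV[int]_d) : set 'rV[int]_d := [set h | h <> 0 /\ h <> k].

Definition cvec (k : 'rV[int]_d) : 'rV[R[i]]_d := \row_r (k 0 r)%:~R.

Definition knorm (k : 'rV[int]_d) : R := cnorm (cvec k).

Definition leray_symbol (k : 'rV[int]_d) (c : 'rV[R[i]]_d) : 'rV[R[i]]_d :=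
  if k == 0 then c else c - (dot (cvec k) c / ((knorm k) ^+ 2)%:C) *: cvec k.

End Lattice.

Section Distributions.
Context {R : realType} {d : nat}.

Definition phase (k : 'rV[int]_d) (x : 'rV[R]_d) : R :=
  \sum_(r < d) (k 0 r)%:~R * x 0 r.

Definition fourier_basis (k : 'rV[int]_d) (x : 'rV[R]_d) : R[i] :=
  (((2 * pi) `^ (d%:R / 2))^-1)%:C * (cos (phase k x) +i* sin (phase k x)).

Definition partial (r : 'I_d) (f : 'rV[R]_d -> R) : 'rV[R]_d -> R :=
  fun x => 'D_(delta_mx 0 r) f x.

Definition partials (s : seq 'I_d) (f : 'rV[R]_d -> R) : 'rV[R]_d -> R :=
  foldr partial f s.

(* Functions on the torus are (2 pi Z)^d-periodic functions on R^d. *)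
Definition torus_periodic (f : 'rV[R]_d -> R) : Prop :=
  forall (k : 'rV[int]_d) (x : 'rV[R]_d),
    f (x + \row_r (2 * pi * (k 0 r)%:~R)) = f x.

Definition test_function (f : 'rV[R]_d -> R) : Prop :=
  torus_periodic f /\ forall (s : seq 'I_d) (x : 'rV[R]_d), differentiable (partials s f) x.

(* A real distribution is given by its values on real test functions; the
   values of the functional elsewhere are irrelevant. *)
Definition functional : Type := ('rV[R]_d -> R) -> R.

(* The torus is compact, so continuity is a bound by one C^N norm. *)
Definition is_distribution (u : functional) : Prop :=
  (forall (a : R) (f g : 'rV[R]_d -> R), test_function f -> test_function g ->
     u (fun x => a * f x + g x) = a * u f + u g) /\
  (exists (C : R) (N : nat), forall f : 'rV[R]_d -> R, test_function f ->
     forall M : R,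
       (forall (s : seq 'I_d) (x : 'rV[R]_d), (size s <= N)%N ->
          `|partials s f x| <= M) ->
       `|u f| <= C * M).

(* Complex-linear extension of a real distribution, applied to a complex f. *)
Definition cpairing (u : functional) (f : 'rV[R]_d -> R[i]) : R[i] :=
  u (fun x => complex.Re (f x)) +i* u (fun x => complex.Im (f x)).

Definition coef (u : functional) (k : 'rV[int]_d) : R[i] :=
  cpairing u (fun x => (fourier_basis k x)^*).

Definition dpartial (r : 'I_d) (u : functional) : functional :=
  fun f => - u (partial r f).

(* The function that a distribution with absolutely summable Fourier
   coefficients is, as the sum of its Fourier expansion. *)
Definition dfun (u : functional) (x : 'rV[R]_d) : R :=
  complex.Re (csum setT (fun k : 'rV[int]_d => coef u k * fourier_basis k x)).

End Distributions.

Arguments functional : clear implicits.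

(* Iterated integral over [0, 2 pi]^d. *)
Fixpoint torus_integral {R : realType} (d : nat) : ('rV[R]_d -> R) -> R :=
  match d return ('rV[R]_d -> R) -> R with
  | 0%N => fun f => f 0
  | d'.+1 => fun f =>
      (\int[lebesgue_measure]_(t in `[0%R, (2 * pi)%R])
         torus_integral (fun y : 'rV[R]_d' =>
           f (row_mx (const_mx t : 'rV[R]_1) y)))%R
  end.

Section VectorDistributions.
Context {R : realType} {d : nat}.

Definition vfunctional : Type := 'I_d -> functional R d.

Definition is_vdistribution (v : vfunctional) : Prop :=
  forall s : 'I_d, is_distribution (v s).

Definition vcoef (v : vfunctional) (k : 'rV[int]_d) : 'rV[R[i]]_d :=
  \row_s coef (v s) k.

Definition regular (f : 'rV[R]_d -> R) : functional R d :=
  fun g => torus_integral (fun x => f x * g x).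

Definition advection (v w : vfunctional) : vfunctional :=
  fun s => regular (fun x =>
    \sum_(r < d) dfun (v r) x * dfun (dpartial r (w s)) x).

(* The Fourier coefficients determine the chosen distribution on test functions. *)
Definition leray (u : vfunctional) : vfunctional :=
  xget (fun _ _ => 0)
    [set z : vfunctional | is_vdistribution z /\
       forall k : 'rV[int]_d, vcoef z k = leray_symbol k (vcoef u k)].

Definition NSmap (v w : vfunctional) : vfunctional := leray (advection v w).

Definition inner (m : R) (v w : vfunctional) : R[i] :=
  csum Z0 (fun k : 'rV[int]_d =>
    (knorm k `^ (2 * m))%:C * dot (conjv (vcoef v k)) (vcoef w k)).

Definition Hnorm (m : R) (v : vfunctional) : R :=
  Num.sqrt (complex.Re (inner m v v)).

Definition Hspace (m : R) : set vfunctional :=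
  [set v | [/\ is_vdistribution v,
    (forall k : 'rV[int]_d, dot (cvec k) (vcoef v k) = 0),
    vcoef v 0 = 0 &
    (\esum_(k in Z0) (knorm k `^ (2 * m) * cnorm (vcoef v k) ^+ 2)%:E < +oo)%E]].

End VectorDistributions.

Arguments vfunctional : clear implicits.

Section Constants.
Context {R : realType} {d : nat}.

Definition Pmap (h l : 'rV[int]_d) (a b : 'rV[R[i]]_d) : 'rV[R[i]]_d :=
  (dot a (cvec l) / (knorm l)%:C) *: leray_symbol (h + l) b.

(* The set is closed, so its infimum is a minimum. *)
Definition Pnorm (h l : 'rV[int]_d) : R :=
  inf [set Q : R | 0 <= Q /\ forall a b : 'rV[R[i]]_d,
    dot (cvec h) a = 0 -> dot (cvec l) b = 0 ->
    cnorm (Pmap h l a b) <= Q * cnorm a * cnorm b].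

Definition Gcal (p n : R) (k : 'rV[int]_d) : \bar R :=
  (4%:E * \esum_(h in Z0k k)
    ((knorm k `^ p - knorm (k - h) `^ p) ^+ 2 * Pnorm h (k - h) ^+ 2 /
     (knorm h `^ p * knorm (k - h) `^ (n - 1) +
      knorm h `^ n * knorm (k - h) `^ (p - 1)) ^+ 2)%:E)%E.

Definition supG (p n : R) : \bar R :=
  ereal_sup [set Gcal p n k | k in (Z0 : set 'rV[int]_d)].

Definition Gplus (p n : R) : R :=
  ((2 * pi) `^ (d%:R / 2))^-1 * Num.sqrt (fine (supG p n)).

Definition kato_bound (p n G : R) (v w : vfunctional R d) : Prop :=
  ComplexField.Normc.normc (inner p (NSmap v w) w) <=
  2^-1 * G * (Hnorm p v * Hnorm n w + Hnorm n v * Hnorm p w) * Hnorm p w.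

Definition kato_constant (p n G : R) : Prop :=
  0 <= G /\ forall v w : vfunctional R d,
    Hspace p v -> Hspace (p + 1) w -> kato_bound p n G v w.

End Constants.

Arguments supG {R} d p n.
Arguments Gplus {R} d p n.
Arguments kato_constant {R} d p n G.

(* Main.v *)
From mathcomp Require Import all_boot all_order all_algebra.
From mathcomp Require Import all_classical all_reals all_analysis.
From mathcomp Require Import finmap ring lra.
Require Import Defs.

(** The estimate is read off the Fourier coefficients. Write l = k - h. The
    coefficient of index k of the advection term is the convolution

      (2 pi)^(-d/2) sum_l i (v_h . l) w_l,

    and w_k is orthogonal to k, so that <P(v, w) | w>_p is a double series over
    the pairs (k, l), with the weight |k|^(2p) ([has_sum_inner_NSmap]). If the
    weight is replaced by |k|^p |l|^p, then the series becomes the one of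
    <P(v, |D|^p w) | |D|^p w>, and its terms cancel in pairs: the map
    (k, l) -> (-l, -k) keeps h and changes the sign of the term, because v is
    real and divergence free ([transport_antisym]). What remains has the factor
    |k|^p (|k|^p - |l|^p), hence each term is at most

      (2 pi)^(-d/2) |k|^p |w_k| q(k, l) (|h|^p |l|^n + |h|^n |l|^p) |v_h| |w_l|,

    where 4 q(k, l)^2 are the terms of G_pn(k) ([commutator_le]). The
    Cauchy-Schwarz inequality over all pairs separates |k|^p |w_k| q(k, l),
    whose l^2 norm is at most sqrt(sup G_pn) / 2 times the norm of w
    ([Gquotient_weighted_l2]), from the other factors, which Minkowski's
    inequality bounds by the mixed products of norms ([Nproduct_l2]). This is
    [kato_inequality].

    The supremum is finite ([supG_lty]) because, by Bernoulli's inequality,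
    q(k, l) is at most a constant times |h|^(1-n) + |l|^(1-n), whose square is
    summable over the lattice for 2 (n - 1) > d ([Gterm_le], [lattice_zeta]).

    The Fourier description has to be established for the given objects. The
    iterated integral is shown to be linear and bounded on functions that are
    uniformly continuous on the box ([torus_integral_spec]), and trigonometric
    monomials are orthogonal for it, so absolutely convergent series are
    integrated term by term and coefficients of products are convolutions
    ([fourier_product_coef]). For v in H^p and w in H^(p+1) the coefficients of
    v and of the gradient of w are absolutely summable, since p > d/2. Young's
    inequality places the convolution, weighted with |k|^p, in l^2
    ([weighted_advection_l2]). Hence the projected series is a function, the
    Leray projection has the expected coefficients ([leray_spec]), and P(v, w)
    belongs to H^p ([NSmap_Hspace]). Finally the constants G form a closed
    half-line, which has a least element ([smallest_kato_constant]). *)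

Set Implicit Arguments.
Unset Strict Implicit.
Unset Printing Implicit Defensive.

Import Order.TTheory GRing.Theory Num.Theory.
Import numFieldNormedType.Exports.

Local Open Scope classical_set_scope.
Local Open Scope ring_scope.
Local Open Scope complex_scope.

Local Notation normc := ComplexField.Normc.normc.
Local Notation Re := complex.Re.
Local Notation Im := complex.Im.

(** * Complex vectors and the Leray symbol *)

Section ComplexModulus.
Context {R : realType}.
Implicit Types z w : R[i].

Lemma normc_ge0 z : 0 <= normc z.
Proof. by case: z => a b; exact: sqrtr_ge0. Qed.

Lemma normc_sqr z : normc z ^+ 2 = Re z ^+ 2 + Im z ^+ 2.
Proof. by case: z => a b /=; rewrite sqr_sqrtr// addr_ge0 ?sqr_ge0. Qed.

Lemma normcJ z : normc z^* = normc z.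
Proof. by case: z => a b /=; rewrite sqrrN. Qed.

Lemma normcR (x : R) : normc x%:C = `|x|.
Proof. by rewrite /= expr0n/= addr0 sqrtr_sqr. Qed.

Lemma normr_Re z : `|Re z| <= normc z.
Proof.
rewrite -(@ler_pXn2r _ 2)// ?nnegrE ?normc_ge0//.
by rewrite normc_sqr real_normK ?num_real// lerDl sqr_ge0.
Qed.

Lemma normr_Im z : `|Im z| <= normc z.
Proof.
rewrite -(@ler_pXn2r _ 2)// ?nnegrE ?normc_ge0//.
by rewrite normc_sqr real_normK ?num_real// lerDr sqr_ge0.
Qed.

Lemma normc_le_ReIm z : normc z <= `|Re z| + `|Im z|.
Proof.
rewrite -(@ler_pXn2r _ 2)// ?nnegrE ?normc_ge0// ?addr_ge0//.
rewrite normc_sqr sqrrD !real_normK ?num_real// -addrA lerD2l lerDr.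
by rewrite mulrn_wge0// mulr_ge0.
Qed.

Lemma normc_sum (I : Type) (s : seq I) (P : pred I) (f : I -> R[i]) :
  normc (\sum_(i <- s | P i) f i) <= \sum_(i <- s | P i) normc (f i).
Proof.
elim/big_rec2 : _ => [|i x y _ h]; first by rewrite ComplexField.Normc.normc0.
by rewrite (le_trans (le_normcD _ _))// lerD2l.
Qed.

Lemma ReD z w : Re (z + w) = Re z + Re w. Proof. by case: z w => ? ? []. Qed.
Lemma ImD z w : Im (z + w) = Im z + Im w. Proof. by case: z w => ? ? []. Qed.
Lemma ReN z : Re (- z) = - Re z. Proof. by case: z. Qed.
Lemma ImN z : Im (- z) = - Im z. Proof. by case: z. Qed.

Lemma Re_sum (I : Type) (s : seq I) (P : pred I) (f : I -> R[i]) :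
  Re (\sum_(i <- s | P i) f i) = \sum_(i <- s | P i) Re (f i).
Proof. by apply: (big_morph (@complex.Re R)) => //; exact: ReD. Qed.

Lemma conjcM z w : conjc (z * w) = conjc z * conjc w.
Proof. exact: rmorphM. Qed.

Lemma conjcD z w : conjc (z + w) = conjc z + conjc w.
Proof. exact: rmorphD. Qed.

Lemma conjcN z : conjc (- z) = - conjc z.
Proof. exact: rmorphN. Qed.

Lemma conjc_sum (I : Type) (s : seq I) (P : pred I) (f : I -> R[i]) :
  conjc (\sum_(i <- s | P i) f i) = \sum_(i <- s | P i) conjc (f i).
Proof. exact: rmorph_sum. Qed.

Lemma eq_conj_Im0 z : z^* = z -> z = (Re z)%:C.
Proof.
case: z => a b [] h.
suff -> : b = 0 by [].
by move: h; lra.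
Qed.

End ComplexModulus.

Section FiniteCauchySchwarz.
Context {R : realType} {I : Type}.
Implicit Types (s : seq I) (x y : I -> R).

(** Lagrange's identity writes the defect as a sum of squares. *)
Lemma cauchy_schwarz_seq s x y :
  (\sum_(i <- s) x i * y i) ^+ 2 <=
  (\sum_(i <- s) x i ^+ 2) * (\sum_(i <- s) y i ^+ 2).
Proof.
rewrite -subr_ge0 -(pmulr_rge0 _ (ltr0Sn _ 1)).
suff -> : 2%:R * ((\sum_(i <- s) x i ^+ 2) * (\sum_(i <- s) y i ^+ 2) -
    (\sum_(i <- s) x i * y i) ^+ 2) =
    \sum_(i <- s) \sum_(j <- s) (x i * y j - x j * y i) ^+ 2.
  by apply: sumr_ge0 => i _; apply: sumr_ge0 => j _; exact: sqr_ge0.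
under [RHS]eq_bigr => i _ do (under eq_bigr => j _ do
  have -> : (x i * y j - x j * y i) ^+ 2 =
  x i ^+ 2 * y j ^+ 2 + y i ^+ 2 * x j ^+ 2 - 2%:R * ((x i * y i) * (x j * y j)) by ring).
under [RHS]eq_bigr => i _ do rewrite sumrB big_split/= -!mulr_sumr.
rewrite sumrB big_split/= -mulr_sumr -!mulr_suml expr2; ring.
Qed.

Lemma cauchy_schwarz_sqrt s x y (X Y : R) : 0 <= X -> 0 <= Y ->
  \sum_(i <- s) x i ^+ 2 <= X ^+ 2 -> \sum_(i <- s) y i ^+ 2 <= Y ^+ 2 ->
  \sum_(i <- s) x i * y i <= X * Y.
Proof.
move=> X0 Y0 hX hY; apply: le_trans (ler_norm _) _.
rewrite -(@ler_pXn2r _ 2)// ?nnegrE ?mulr_ge0//.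
rewrite real_normK ?num_real// (le_trans (cauchy_schwarz_seq _ _ _))// exprMn.
by apply: ler_pM => //; apply: sumr_ge0 => i _; exact: sqr_ge0.
Qed.

End FiniteCauchySchwarz.

Section ComplexVectorNorm.
Context {R : realType} {d : nat}.
Implicit Types a b c : 'rV[R[i]]_d.

Lemma dotC a b : dot a b = dot b a.
Proof. by apply: eq_bigr => r _; rewrite mulrC. Qed.

Lemma dotDl a b c : dot (a + b) c = dot a c + dot b c.
Proof. by rewrite -big_split/=; apply: eq_bigr => r _; rewrite mxE mulrDl. Qed.

Lemma dotZl x a b : dot (x *: a) b = x * dot a b.
Proof. by rewrite /dot mulr_sumr; apply: eq_bigr => r _; rewrite mxE mulrA. Qed.

Lemma dotDr a b c : dot a (b + c) = dot a b + dot a c.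
Proof. by rewrite dotC dotDl !(dotC a). Qed.

Lemma dotZr x a b : dot a (x *: b) = x * dot a b.
Proof. by rewrite dotC dotZl dotC. Qed.

Lemma dot0l a : dot 0 a = 0.
Proof. by rewrite -(scale0r 0) dotZl mul0r. Qed.

Lemma dot0r a : dot a 0 = 0. Proof. by rewrite dotC dot0l. Qed.

Lemma dotNl a b : dot (- a) b = - dot a b.
Proof. by rewrite -scaleN1r dotZl mulN1r. Qed.

Lemma dotNr a b : dot a (- b) = - dot a b.
Proof. by rewrite dotC dotNl dotC. Qed.

Lemma conjvK a : conjv (conjv a) = a.
Proof. by apply/rowP => r; rewrite !mxE conjcK. Qed.

Lemma conjvD a b : conjv (a + b) = conjv a + conjv b.
Proof. by apply/rowP => r; rewrite !mxE rmorphD. Qed.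

Lemma conjvZ x a : conjv (x *: a) = conjc x *: conjv a.
Proof. by apply/rowP => r; rewrite !mxE rmorphM. Qed.

Lemma conjvN a : conjv (- a) = - conjv a.
Proof. by apply/rowP => r; rewrite !mxE rmorphN. Qed.

Lemma conj_dot a b : (dot a b)^* = dot (conjv a) (conjv b).
Proof.
by rewrite /dot rmorph_sum; apply: eq_bigr => r _; rewrite !mxE rmorphM.
Qed.

Lemma dot_conjvv a : dot (conjv a) a = (\sum_(r < d) normc (a 0 r) ^+ 2)%:C.
Proof.
rewrite rmorph_sum; apply: eq_bigr => r _; rewrite !mxE.
case: (a 0 r) => x y.
rewrite normc_sqr /=; apply/eqP; rewrite eq_complex/=; apply/andP; split; apply/eqP; ring.
Qed.

Lemma cnorm_ge0 a : 0 <= cnorm a. Proof. exact: sqrtr_ge0. Qed.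

Lemma cnorm_sqr a : cnorm a ^+ 2 = \sum_(r < d) normc (a 0 r) ^+ 2.
Proof.
rewrite /cnorm dot_conjvv sqr_sqrtr//=.
by apply: sumr_ge0 => i _; exact: sqr_ge0.
Qed.

Lemma dot_conjvv_cnorm a : dot (conjv a) a = (cnorm a ^+ 2)%:C.
Proof. by rewrite dot_conjvv cnorm_sqr. Qed.

Lemma cnorm_conjv a : cnorm (conjv a) = cnorm a.
Proof.
apply/eqP; rewrite -(@eqrXn2 _ 2)// ?cnorm_ge0// !cnorm_sqr.
by apply/eqP; apply: eq_bigr => r _; rewrite mxE normcJ.
Qed.

Lemma cnormZ x a : cnorm (x *: a) = normc x * cnorm a.
Proof.
apply/eqP; rewrite -(@eqrXn2 _ 2)// ?mulr_ge0 ?normc_ge0 ?cnorm_ge0//.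
rewrite exprMn !cnorm_sqr mulr_sumr; apply/eqP; apply: eq_bigr => r _.
by rewrite mxE ComplexField.Normc.normcM exprMn.
Qed.

Lemma cnorm0 : cnorm (0 : 'rV[R[i]]_d) = 0.
Proof. by rewrite -(scale0r 0) cnormZ ComplexField.Normc.normc0 mul0r. Qed.

Lemma cnormN a : cnorm (- a) = cnorm a.
Proof. by rewrite -scaleN1r cnormZ normcN ComplexField.Normc.normc1 mul1r. Qed.

Lemma normc_entry a r : normc (a 0 r) <= cnorm a.
Proof.
rewrite -(@ler_pXn2r _ 2)// ?nnegrE ?normc_ge0 ?cnorm_ge0//.
rewrite cnorm_sqr (bigD1 r)//= lerDl; apply: sumr_ge0 => i _; exact: sqr_ge0.
Qed.

Lemma normc_dot a b : normc (dot a b) <= cnorm a * cnorm b.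
Proof.
apply: le_trans (normc_sum _ _ _) _.
under eq_bigr do rewrite ComplexField.Normc.normcM.
by apply: cauchy_schwarz_sqrt; rewrite ?cnorm_ge0// cnorm_sqr.
Qed.

Lemma cnormD a b : cnorm (a + b) <= cnorm a + cnorm b.
Proof.
rewrite -(@ler_pXn2r _ 2)// ?nnegrE ?cnorm_ge0// ?addr_ge0 ?cnorm_ge0//.
have -> : cnorm (a + b) ^+ 2 = Re (dot (conjv (a + b)) (a + b)).
  by rewrite dot_conjvv_cnorm.
have -> : dot (conjv (a + b)) (a + b) =
  (cnorm a ^+ 2)%:C + (dot (conjv a) b + dot (conjv b) a + (cnorm b ^+ 2)%:C).
  by rewrite conjvD dotDl !dotDr !dot_conjvv_cnorm !addrA.
have hu : Re (dot (conjv a) b) <= cnorm a * cnorm b.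
  apply: le_trans (ler_norm _) _; apply: le_trans (normr_Re _) _.
  by apply: le_trans (normc_dot _ _) _; rewrite cnorm_conjv.
have hv : Re (dot (conjv b) a) <= cnorm a * cnorm b.
  apply: le_trans (ler_norm _) _; apply: le_trans (normr_Re _) _.
  by apply: le_trans (normc_dot _ _) _; rewrite cnorm_conjv mulrC.
by rewrite !ReD/=; move: hu hv; set u := Re _; set v := Re _; lra.
Qed.

Lemma cnorm_le_sum a : cnorm a <= \sum_(r < d) normc (a 0 r).
Proof.
rewrite -(@ler_pXn2r _ 2)// ?nnegrE ?cnorm_ge0// ?sumr_ge0// => [|r _]; last exact: normc_ge0.
rewrite cnorm_sqr expr2 mulr_suml; apply: ler_sum => r _.
rewrite expr2 ler_wpM2l ?normc_ge0// (bigD1 r)//= lerDl.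
by apply: sumr_ge0 => i _; exact: normc_ge0.
Qed.

End ComplexVectorNorm.

Section WaveVectors.
Context {R : realType} {d : nat}.
Implicit Types (k h l : 'rV[int]_d) (c : 'rV[R[i]]_d).
Local Notation cvec := (@cvec R d).
Local Notation knorm := (@knorm R d).

Lemma cvecD h l : cvec (h + l) = cvec h + cvec l.
Proof. by apply/rowP => r; rewrite !mxE rmorphD. Qed.

Lemma cvecN h : cvec (- h) = - cvec h.
Proof. by apply/rowP => r; rewrite !mxE rmorphN. Qed.

Lemma cvecB h l : cvec (h - l) = cvec h - cvec l.
Proof. by rewrite cvecD cvecN. Qed.

Lemma cvec0 : cvec 0 = 0.
Proof. by apply/rowP => r; rewrite !mxE. Qed.

Lemma intc_real (m : int) : (m%:~R : R[i]) = (m%:~R : R)%:C.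
Proof. by rewrite rmorph_int. Qed.

Lemma conjv_cvec k : conjv (cvec k) = cvec k.
Proof. by apply/rowP => r; rewrite !mxE intc_real conjc_real. Qed.

Lemma knorm_ge0 k : 0 <= knorm k. Proof. exact: cnorm_ge0. Qed.

Lemma knormN k : knorm (- k) = knorm k.
Proof. by rewrite /Defs.knorm cvecN cnormN. Qed.

Lemma knormD h l : knorm (h + l) <= knorm h + knorm l.
Proof. by rewrite /Defs.knorm cvecD; exact: cnormD. Qed.

Lemma knorm0 : knorm 0 = 0.
Proof. by rewrite /Defs.knorm cvec0 cnorm0. Qed.

Lemma knorm_entry k r : `|(k 0 r)%:~R| <= knorm k :> R.
Proof. by apply: le_trans (normc_entry _ r); rewrite mxE intc_real normcR. Qed.

Lemma knorm_ge1 k : k != 0 -> 1 <= knorm k.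
Proof.
move=> k0; have [r kr] : exists r, k 0 r != 0.
  apply/existsP; rewrite -negb_forall; apply: contra k0 => /forallP h.
  by apply/eqP/rowP => r; rewrite mxE; exact/eqP.
apply: le_trans (knorm_entry k r).
by rewrite -intr_norm -[1]/(1%:~R) ler_int; move: kr; case: (k 0 r) => [[|n]|n].
Qed.

Lemma knorm_gt0 k : k != 0 -> 0 < knorm k.
Proof. by move/knorm_ge1; apply: lt_le_trans. Qed.

Lemma dot_cvecvv k : dot (cvec k) (cvec k) = (knorm k ^+ 2)%:C.
Proof. by rewrite -{1}conjv_cvec dot_conjvv_cnorm. Qed.

Lemma dot_cvec_leray k c : dot (cvec k) (leray_symbol k c) = 0.
Proof.
rewrite /leray_symbol; case: eqP => [->|/eqP k0]; first by rewrite cvec0 dot0l.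
rewrite dotDr dotNr dotZr.
rewrite dot_cvecvv mulfVK ?subrr//.
by rewrite -[0]/(0%:C) (inj_eq (@complexI _)) expf_neq0// gt_eqF// knorm_gt0.
Qed.

Lemma leray_symbolZ k x c : leray_symbol k (x *: c) = x *: leray_symbol k c.
Proof.
rewrite /leray_symbol; case: ifP => // _.
by rewrite dotZr scalerBr scalerA mulrA.
Qed.

(** Pythagoras: the two summands on the right are orthogonal. *)
Lemma cnorm_orthogonal_part k (L : 'rV[R[i]]_d) x : dot (cvec k) L = 0 ->
  cnorm L <= cnorm (L + x *: cvec k).
Proof.
move=> hL; rewrite -(@ler_pXn2r _ 2)// ?nnegrE ?cnorm_ge0//.
rewrite -lecR -!dot_conjvv_cnorm [in leRHS]conjvD dotDl !dotDr.
rewrite conjvZ conjv_cvec !dotZl !dotZr hL.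
have -> : dot (conjv L) (cvec k) = 0.
  by rewrite -[in LHS](conjv_cvec k) -conj_dot dotC hL conjc0.
rewrite !mulr0 addr0 add0r dot_cvecvv lerDl mulrA.
by rewrite mulr_ge0// ?ler0c ?sqr_ge0// mulrC mulcJ_ge0.
Qed.

Lemma cnorm_leray k c : cnorm (leray_symbol k c) <= cnorm c.
Proof.
have := dot_cvec_leray k c; rewrite /leray_symbol.
case: eqP => // _; set x := _ / _ => hL.
by apply: le_trans (cnorm_orthogonal_part x hL) _; rewrite subrK.
Qed.

Lemma conjv_leray k c : conjv (leray_symbol k c) = leray_symbol k (conjv c).
Proof.
rewrite /leray_symbol; case: ifP => // _.
rewrite conjvD conjvN conjvZ conjv_cvec.
rewrite conjcM conj_dot conjv_cvec.
by congr (_ - (_ * _) *: _); rewrite -fmorphV; exact: conjc_real.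
Qed.

Lemma leray_symbolN k c : leray_symbol (- k) c = leray_symbol k c.
Proof.
rewrite /leray_symbol oppr_eq0; case: ifP => // _.
by rewrite cvecN dotNl knormN scalerN mulNr scaleNr opprK.
Qed.

Lemma dot_conjv_leray k c b : dot (cvec k) b = 0 ->
  dot (conjv (leray_symbol k c)) b = dot (conjv c) b.
Proof.
move=> hb; rewrite /leray_symbol; case: ifP => // _.
by rewrite conjvD conjvN conjvZ conjv_cvec dotDl dotNl dotZl hb mulr0 subr0.
Qed.

End WaveVectors.

(** * Unconditional sums *)

Section FinitePartialSums.
Context {I : choiceType}.

Lemma fsum_split (V : nmodType) (F G : {fset I}) (f : I -> V) :
  (F `<=` G)%fset ->
  \sum_(i <- G) f i = \sum_(i <- F) f i + \sum_(i <- (G `\` F)%fset) f i.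
Proof.
move=> FG; rewrite -big_cat/=; apply: perm_big; apply: uniq_perm => //.
  rewrite cat_uniq !fset_uniq/= andbT; apply/hasPn => i.
  by rewrite /= in_fsetD => /andP[].
move=> i; rewrite mem_cat in_fsetD.
by have [/(fsubsetP FG) ->|] := boolP (i \in F).
Qed.

Lemma fsetM_sum (J : choiceType) (V : nmodType) (F : {fset I}) (G : {fset J})
    (f : I * J -> V) :
  \sum_(x <- (F `*` G)%fset) f x = \sum_(i <- F) \sum_(j <- G) f (i, j).
Proof.
have -> : \sum_(i <- F) \sum_(j <- G) f (i, j) =
    \sum_(x <- [seq (i, j) | i <- F, j <- G]) f x by rewrite big_allpairs_dep.
apply: perm_big; apply: uniq_perm => //.
  by apply: allpairs_uniq => // [[i j] [i' j']] _ _ /= [-> ->].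
move=> [i j]; rewrite in_fsetM/=; apply/andP/allpairsP => [[iF jG]|].
  by exists (i, j).
by move=> [[i' j'] /= [? ? [-> ->]]].
Qed.

Context {R : realType}.
Implicit Types (g : I -> R) (F G : {fset I}).

Lemma fsum_le_subset g F G : (forall i, 0 <= g i) -> (F `<=` G)%fset ->
  \sum_(i <- F) g i <= \sum_(i <- G) g i.
Proof. by move=> g0 FG; rewrite (fsum_split g FG) lerDl sumr_ge0. Qed.

(** For a nonnegative family this says that it is summable with sum at most
    [M]. Only finite sums occur, so that estimates need no passage to a
    limit. *)
Definition sum_le g (M : R) := forall F, \sum_(i <- F) g i <= M.

Lemma sum_le_ge0 g M : sum_le g M -> 0 <= M.
Proof. by move/(_ fset0); rewrite big_nil. Qed.

Lemma sum_le_mono g g' M : (forall i, g' i <= g i) -> sum_le g M -> sum_le g' M.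
Proof. by move=> gg' h F; apply: le_trans (h F); exact: ler_sum. Qed.

Lemma sum_leD g g' M M' : sum_le g M -> sum_le g' M' ->
  sum_le (fun i => g i + g' i) (M + M').
Proof. by move=> h h' F; rewrite big_split/=; exact: lerD. Qed.

Lemma sum_leZ (c : R) g M : 0 <= c -> sum_le g M ->
  sum_le (fun i => c * g i) (c * M).
Proof. by move=> c0 h F; rewrite -mulr_sumr ler_wpM2l. Qed.

(** A partial sum that is within [e] of the supremum leaves at most [e] for all
    further indices. *)
Lemma sum_le_tail g M (e : R) : (forall i, 0 <= g i) -> sum_le g M -> 0 < e ->
  exists F0, forall F, (F0 `<=` F)%fset -> forall G, (F `<=` G)%fset ->
    \sum_(i <- (G `\` F)%fset) g i <= e.
Proof.
move=> g0 gM e0; pose S := [set \sum_(i <- F) g i | F in [set: {fset I}]].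
have S_ub : has_sup S.
  split; first by exists (\sum_(i <- fset0) g i); exists fset0.
  by exists M => _ [F _ <-]; exact: gM.
have [_ [F0 _ <-] hF0] := sup_adherent e0 S_ub.
exists F0 => F F0F G FG; rewrite -(lerD2l (\sum_(i <- F) g i)) -fsum_split//.
have h : \sum_(i <- G) g i <= sup S by apply: ub_le_sup; [case: S_ub|exists G].
apply: (le_trans h); rewrite -lerBlDr; apply: le_trans (ltW hF0) _.
exact: fsum_le_subset.
Qed.

End FinitePartialSums.

(** Summing over an injective image visits no index twice. *)
Lemma sum_le_inj (R : realType) (I J : choiceType) (g : I -> R) (s : J -> I) M :
  injective s -> sum_le g M -> sum_le (g \o s) M.
Proof.
move=> sI h F; apply: le_trans (h [fset s i | i in F]%fset).
by rewrite big_imfset//= => i j _ _; exact: sI.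
Qed.

Section UnconditionalSums.
Context {R : realType}.

(** Unconditional convergence. The index sets (lattices and products of
    lattices) carry no order, and reindexing and pairing of sums are immediate
    for the net of finite sets. *)
Definition has_sum (I : choiceType) (f : I -> R[i]) (s : R[i]) : Prop :=
  forall e : R, 0 < e -> exists F0 : {fset I}, forall F : {fset I},
    (F0 `<=` F)%fset -> normc (\sum_(i <- F) f i - s) <= e.

Section OneFamily.
Context {I : choiceType}.
Implicit Types (f : I -> R[i]) (s : R[i]) (F : {fset I}).

Lemma normc_le_eps s : (forall e, 0 < e -> normc s <= e) -> s = 0.
Proof.
move=> h; apply: ComplexField.Normc.eq0_normc; apply/le_anti.
rewrite normc_ge0 andbT; apply/ler_addgt0Pl => e e0; rewrite addr0; exact: h.
Qed.

Lemma normcB s t : normc (s - t) = normc (t - s).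
Proof. by rewrite -normcN opprB. Qed.

Lemma has_sum_unique f s t : has_sum f s -> has_sum f t -> s = t.
Proof.
move=> hs ht; apply/eqP; rewrite -subr_eq0; apply/eqP/normc_le_eps => e e0.
have e20 : 0 < e / 2 by lra.
have [F0 h0] := hs _ e20; have [F1 h1] := ht _ e20.
have h0' := h0 _ (fsubsetUl F0 F1); have h1' := h1 _ (fsubsetUr F0 F1).
rewrite -(subrKA (\sum_(i <- (F0 `|` F1)%fset) f i)).
by apply: le_trans (le_normcD _ _) _; rewrite normcB; lra.
Qed.

Lemma has_sum0 : has_sum (fun _ : I => 0) 0.
Proof.
move=> e e0; exists fset0 => F _; rewrite big1// subrr.
by rewrite ComplexField.Normc.normc0 ltW.
Qed.

Lemma has_sumD f g s t : has_sum f s -> has_sum g t ->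
  has_sum (fun i => f i + g i) (s + t).
Proof.
move=> hs ht e e0; have e20 : 0 < e / 2 by lra.
have [F0 h0] := hs _ e20; have [F1 h1] := ht _ e20.
exists (F0 `|` F1)%fset => F; rewrite fsubUset => /andP[/h0 h0' /h1 h1'].
rewrite big_split/= opprD addrACA.
by apply: le_trans (le_normcD _ _) _; lra.
Qed.

Lemma has_sumZ (c : R[i]) f s : has_sum f s -> has_sum (fun i => c * f i) (c * s).
Proof.
move=> hs e e0.
have n0 : 0 < normc c + 1 by rewrite ltr_wpDl// normc_ge0.
have [F0 h0] := hs (e / (normc c + 1)) (divr_gt0 e0 n0).
exists F0 => F /h0 h; rewrite -mulr_sumr -mulrBr ComplexField.Normc.normcM.
apply: (@le_trans _ _ ((normc c + 1) * (e / (normc c + 1)))).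
  by apply: ler_pM; rewrite ?normc_ge0// lerDl.
by rewrite mulrC divfK// gt_eqF.
Qed.

Lemma has_sumZr (c : R[i]) f s : has_sum f s -> has_sum (fun i => f i * c) (s * c).
Proof.
rewrite mulrC => /(has_sumZ c) h.
by have -> : (fun i => f i * c) = (fun i => c * f i) by apply/funext => i; rewrite mulrC.
Qed.

Lemma has_sum_big (J : Type) (r : seq J) (f : J -> I -> R[i]) (s : J -> R[i]) :
  (forall j, has_sum (f j) (s j)) ->
  has_sum (fun i => \sum_(j <- r) f j i) (\sum_(j <- r) s j).
Proof.
move=> h; elim: r => [|j r IH].
  by rewrite big_nil; under eq_fun do rewrite big_nil; exact: has_sum0.
by rewrite big_cons; under eq_fun do rewrite big_cons; exact: has_sumD.
Qed.

Lemma has_sum_conj f s : has_sum f s -> has_sum (fun i => conjc (f i)) (conjc s).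
Proof.
move=> h e /h[F0 h0]; exists F0 => F /h0.
by rewrite -conjc_sum -conjcN -conjcD normcJ.
Qed.

Lemma has_sum_normc_le f s (M : R) : has_sum f s ->
  (forall F0 : {fset I}, exists2 F, (F0 `<=` F)%fset & normc (\sum_(i <- F) f i) <= M) ->
  normc s <= M.
Proof.
move=> h hM; apply/ler_addgt0Pr => e /h[F0 h0].
have [F /h0 h1 h2] := hM F0.
rewrite -(subrK (\sum_(i <- F) f i) s).
by apply: le_trans (le_normcD _ _) _; rewrite normcB addrC; exact: lerD.
Qed.

Lemma has_sum_normc_sum_le f s M : has_sum f s ->
  sum_le (fun i => normc (f i)) M -> normc s <= M.
Proof.
move=> h hM; apply: has_sum_normc_le h _ => F0; exists F0; rewrite ?fsubset_refl//.
by apply: le_trans (normc_sum _ _ _) (hM F0).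
Qed.

(** One finite set serves all families dominated by [g]: Fourier series with
    absolutely summable coefficients converge uniformly. *)
Lemma has_sum_dominated_uniform (g : I -> R) M (e : R) :
  (forall i, 0 <= g i) -> sum_le g M -> 0 < e ->
  exists F0 : {fset I}, forall F, (F0 `<=` F)%fset -> forall f s,
    (forall i, normc (f i) <= g i) -> has_sum f s ->
    normc (\sum_(i <- F) f i - s) <= e.
Proof.
move=> g0 gM e0; have [F0 h0] := sum_le_tail g0 gM e0.
exists F0 => F F0F f s fg hs; rewrite normcB.
apply/ler_addgt0Pr => e' /hs[F1 h1].
have := h1 _ (fsubsetUl F1 F); have := h0 _ F0F _ (fsubsetUr F1 F).
rewrite (fsum_split f (fsubsetUr F1 F)).
set S := \sum_(i <- F) _; set T := \sum_(i <- _) f _.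
move=> hg hT.
have -> : s - S = T - (S + T - s) by ring.
apply: le_trans (le_normcD _ _) _; rewrite normcN; apply: lerD => //.
apply: le_trans (normc_sum _ _ _) _; apply: le_trans hg.
by apply: ler_sum => i _; exact: fg.
Qed.

End OneFamily.

Lemma has_sum_reindex (I J : choiceType) (u : J -> I) (v : I -> J)
    (f : I -> R[i]) s :
  cancel u v -> cancel v u -> has_sum f s -> has_sum (f \o u) s.
Proof.
move=> uK vK h e /h[F0 h0]; exists [fset v i | i in F0]%fset => F F0F.
have -> : \sum_(i <- F) (f \o u) i = \sum_(i <- [fset u i | i in F]%fset) f i.
  by rewrite big_imfset//= => i j _ _; exact: (can_inj uK).
apply: h0; apply/fsubsetP => i iF0; apply/imfsetP; exists (v i) => //=.
by apply: (fsubsetP F0F); apply/imfsetP; exists i.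
Qed.

(** Finitely many row sums are approximated by one common finite set of
    columns, so a partial sum of row sums is close to a sum over a finite
    rectangle. *)
Lemma has_sum_pair (I J : choiceType) (f : I * J -> R[i]) (g : I -> R[i]) s :
  has_sum f s -> (forall i, has_sum (fun j => f (i, j)) (g i)) -> has_sum g s.
Proof.
move=> hf hg e e0; have e20 : 0 < e / 2 by lra.
have [F0 h0] := hf _ e20.
exists [fset x.1 | x in F0]%fset => F F0F.
have [G0 h1] := has_sum_big F hg e20.
pose G := (G0 `|` [fset x.2 | x in F0])%fset.
have := h1 _ (fsubsetUl _ _ : G0 `<=` G)%fset.
have /h0 : (F0 `<=` F `*` G)%fset.
  apply/fsubsetP => x xF0; rewrite in_fsetM; apply/andP; split.
    by apply: (fsubsetP F0F); apply/imfsetP; exists x.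
  by rewrite in_fsetU; apply/orP; right; apply/imfsetP; exists x.
rewrite fsetM_sum exchange_big/=.
set S := \sum_(i <- G) _; set T := \sum_(i <- F) _ => hS hT.
have -> : T - s = (T - S) + (S - s) by rewrite addrA subrK.
by apply: le_trans (le_normcD _ _) _; rewrite (normcB T); lra.
Qed.

Section AbsolutelySummable.
Context {I : choiceType}.
Implicit Types (S : set I).
Local Open Scope ereal_scope.

Lemma fsbig_EFin (F : {fset I}) (g : I -> R) :
  \sum_(i \in [set` F]) (g i)%:E = (\sum_(i <- F) g i)%:E.
Proof. by rewrite -fsbig_seq// sumEFin. Qed.

Lemma sum_le_esum S (g : I -> R) M : sum_le g M ->
  \esum_(i in S) (g i)%:E <= M%:E.
Proof.
move=> gM; apply: ge_ereal_sup => _ [A [finA _] <-].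
by rewrite -(fset_setK finA) fsbig_EFin lee_fin.
Qed.

Lemma esum_sum_le S (g : I -> R) M : (forall i, (0 <= g i)%R) ->
  (forall i, ~ S i -> g i = 0%R) ->
  \esum_(i in S) (g i)%:E <= M%:E -> sum_le g M.
Proof.
move=> g0 gS h F; rewrite -lee_fin; apply: le_trans h.
have -> : \esum_(i in S) (g i)%:E = \esum_(i in setT) (g i)%:E.
  rewrite [LHS]esum_mkcond; apply: eq_esum => i _; case: ifPn => //.
  by rewrite notin_setE => /gS ->.
apply: esum_ge; exists [set` F]; first by split.
by rewrite fsbig_EFin.
Qed.

Lemma has_sum_esum S (g : I -> R) M : (forall i, (0 <= g i)%R) ->
  (forall i, ~ S i -> g i = 0%R) -> sum_le g M ->
  has_sum (fun i => (g i)%:C) (fine (\esum_(i in S) (g i)%:E))%:C.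
Proof.
move=> g0 gS gM.
have fin : \esum_(i in S) (g i)%:E \is a fin_num.
  rewrite ge0_fin_numE; last by apply: esum_ge0 => i _; rewrite lee_fin.
  by rewrite (le_lt_trans (sum_le_esum S gM))// ltry.
have gT : sum_le g (fine (\esum_(i in S) (g i)%:E)).
  by apply: (@esum_sum_le S) => //; rewrite fineK.
move=> e e0.
have [_ [A [finA AS] <-]] := ub_ereal_sup_adherent e0 fin.
rewrite -(fset_setK finA) fsbig_EFin => hA.
exists (fset_set A) => F AF.
have -> (t : R) : (\sum_(i <- F) (g i)%:C - t%:C = (\sum_(i <- F) g i - t)%:C)%R.
  by rewrite rmorphB rmorph_sum.
rewrite normcR distrC ger0_norm ?subr_ge0//.
rewrite lerBlDr -lerBlDl; apply: le_trans (fsum_le_subset g0 AF).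
by rewrite -lee_fin EFinB fineK// ltW.
Qed.

Local Close Scope ereal_scope.

(** The positive and negative parts have finite sums, so the difference that
    defines [rsum] is the true sum. *)
Lemma has_sum_rsum S (f : I -> R) M : (forall i, ~ S i -> f i = 0) ->
  sum_le (fun i => `|f i|) M -> has_sum (fun i => (f i)%:C) (rsum S f)%:C.
Proof.
move=> fS fM; rewrite /rsum.
have pE : (\esum_(i in S) ((EFin \o f)^\+ i) = \esum_(i in S) (Num.max (f i) 0)%:E)%E.
  by apply: eq_esum => i _; rewrite funeposE/= EFin_max.
have nE : (\esum_(i in S) ((EFin \o f)^\- i) = \esum_(i in S) (Num.max (- f i) 0)%:E)%E.
  by apply: eq_esum => i _; rewrite funenegE/= EFin_max.
have hp : sum_le (fun i => Num.max (f i) 0) M.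
  by apply: sum_le_mono fM => i; rewrite ge_max normr_ge0 ler_norm.
have hn : sum_le (fun i => Num.max (- f i) 0) M.
  by apply: sum_le_mono fM => i; rewrite ge_max normr_ge0 -normrN ler_norm.
have fin g : sum_le g M -> (forall i, 0 <= g i) ->
    (\esum_(i in S) (g i)%:E)%E \is a fin_num.
  move=> h g0; rewrite ge0_fin_numE; last by apply: esum_ge0 => i _; rewrite lee_fin.
  by rewrite (le_lt_trans (sum_le_esum S h))// ltry.
rewrite pE nE fineB; last 2 first.
- by apply: fin => // i; rewrite le_max lexx orbT.
- by apply: fin => // i; rewrite le_max lexx orbT.
have mx0 (x : R) : 0 <= Num.max x 0 by rewrite le_max lexx orbT.
have fSp i : ~ S i -> Num.max (f i) 0 = 0 by move/fS ->; rewrite maxxx.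
have fSn i : ~ S i -> Num.max (- f i) 0 = 0 by move/fS ->; rewrite oppr0 maxxx.
have Hp := has_sum_esum (fun i => mx0 (f i)) fSp hp.
have Hn := has_sum_esum (fun i => mx0 (- f i)) fSn hn.
have := has_sumD Hp (has_sumZ (-1) Hn).
rewrite mulN1r -rmorphB.
congr (has_sum _ _); apply/funext => i.
rewrite mulN1r -rmorphB; congr _%:C.
have [h|] := boolP (0 <= f i); last rewrite -ltNge => h.
  by rewrite (max_l h) max_r ?oppr_le0// subr0.
by rewrite (max_r (ltW h)) max_l ?oppr_ge0 ?ltW// sub0r opprK.
Qed.

Lemma has_sum_csum S (f : I -> R[i]) M : (forall i, ~ S i -> f i = 0) ->
  sum_le (fun i => normc (f i)) M -> has_sum f (csum S f).
Proof.
move=> fS fM.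
have hRe : sum_le (fun i => `|Re (f i)|) M.
  by apply: sum_le_mono fM => i; exact: normr_Re.
have hIm : sum_le (fun i => `|Im (f i)|) M.
  by apply: sum_le_mono fM => i; exact: normr_Im.
have fSRe i : ~ S i -> Re (f i) = 0 by move/fS ->.
have fSIm i : ~ S i -> Im (f i) = 0 by move/fS ->.
have := has_sumD (has_sum_rsum fSRe hRe) (has_sumZ 'i%C (has_sum_rsum fSIm hIm)).
have -> : (fun i => (Re (f i))%:C + 'i%C * (Im (f i))%:C) = f.
  by apply/funext => i; rewrite -complexE.
set s := _ + _; have -> : s = csum S f by rewrite [RHS]complexE.
by [].
Qed.

End AbsolutelySummable.

End UnconditionalSums.

(** * The iterated integral over the torus *)

Section BoxContinuity.
Context {R : realType}.

Definition two_pi : R := 2 * pi.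
Local Notation tau := two_pi.

Lemma two_pi_gt0 : 0 < tau. Proof. by rewrite mulr_gt0// pi_gt0. Qed.

Definition box d : set 'rV[R]_d := [set x | forall r, 0 <= x 0 r <= tau].

Definition box_ucont d (f : 'rV[R]_d -> R) : Prop :=
  forall e : R, 0 < e -> exists2 delta : R, 0 < delta & forall x y, box x -> box y ->
    (forall r, `|x 0 r - y 0 r| <= delta) -> `|f x - f y| <= e.

Definition box_bounded d (f : 'rV[R]_d -> R) : Prop :=
  exists M : R, forall x, box x -> `|f x| <= M.

(** The integrands of the iterated integral. Uniform continuity, unlike
    continuity, passes at once to the function of the first variable that is
    left after integrating over the other ones. *)
Definition box_regular d (f : 'rV[R]_d -> R) : Prop :=
  box_ucont f /\ box_bounded f.

Section Closure.
Context {d : nat}.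
Implicit Types f g : 'rV[R]_d -> R.

Lemma box_compact : compact (@box d).
Proof.
have -> : @box d = [set v | forall i : 'I_d, `[0%R, tau]%classic (v ord0 i)].
  by apply/seteqP; split => x /= h i; have := h i; rewrite in_itv.
apply: (@rV_compact _ _ (fun=> `[0%R, tau]%classic)) => i; exact: segment_compact.
Qed.

(** Heine-Cantor on the compact box. *)
Lemma continuous_box_regular f : continuous f -> box_regular f.
Proof.
move=> cf; split.
- move=> e e0; have e20 : 0 < e / 2 by lra.
  have /compact_near_coveringP cov := box_compact.
  pose P (delta : R) (x : 'rV[R]_d) := forall y : 'rV[R]_d,
    (forall r, `|x 0 r - y 0 r| <= delta) -> `|f x - f y| <= e.
  have : \forall delta \near 0^'+, @box d `<=` P delta.
    apply: (cov R 0^'+ P _) => x _.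
    have /cvgrPdist_le/(_ _ e20)/nbhs_ballP[eta /= eta0 h] := cf x.
    exists (ball x (eta / 2), [set delta | delta < eta / 2]) => /=.
      split; first by apply: nbhsx_ballx; exact: divr_gt0.
      by apply: nbhs_right_lt; exact: divr_gt0.
    case=> x' delta [hx' hdelta] y xy; rewrite /= in hx' hdelta xy *.
    have hx'r r : `|x 0 r - x' 0 r| < eta / 2 by apply: hx'.2.
    have hx : ball x eta x'.
      split => // i j; rewrite ord1; apply: lt_trans (hx'r j) _; lra.
    have hy : ball x eta y.
      split => // i j; rewrite ord1; rewrite /ball/=.
      apply: le_lt_trans (ler_distD (x' 0 j) _ _) _.
      have := hx'r j; have := xy j; lra.
    have := h _ hy; have := h _ hx; rewrite /= !ler_norml; lra.
  move=> h.
  have [delta] := @filter_ex _ _ (at_right_proper_filter 0) _ (filterI h (nbhs_right_gt 0)).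
  move=> [hd d0]; exists delta => // x y bx _; exact: hd.
- have h : compact [set f x | x in @box d].
    apply: continuous_compact box_compact; exact: continuous_subspaceT.
  have [M [_ hM]] := compact_bounded h.
  exists (M + 1) => x bx; apply: (hM (M + 1)); first by lra.
  by exists x.
Qed.

Lemma box_regular_cst c : box_regular (fun _ : 'rV[R]_d => c).
Proof.
split; last by exists `|c|.
by move=> e e0; exists 1 => // *; rewrite subrr normr0 ltW.
Qed.

Lemma box_regular_lin (a : R) f g : box_regular f -> box_regular g ->
  box_regular (fun x => a * f x + g x).
Proof.
move=> [cf [Mf hf]] [cg [Mg hg]]; split; last first.
  exists (`|a| * Mf + Mg) => x bx; apply: le_trans (ler_normD _ _) _.
  by rewrite normrM lerD ?hg// ler_wpM2l ?hf.
move=> e e0; have a0 : 0 < `|a| + 1 by rewrite ltr_wpDl.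
have [d1 d10 h1] := cf (e / 2 / (`|a| + 1)) (divr_gt0 (divr_gt0 e0 (ltr0Sn _ _)) a0).
have [d2 d20 h2] := cg (e / 2) (divr_gt0 e0 (ltr0Sn _ _)).
exists (Num.min d1 d2) => [|x y bx byy xy]; first by rewrite lt_min d10.
have -> : a * f x + g x - (a * f y + g y) = a * (f x - f y) + (g x - g y) by ring.
apply: le_trans (ler_normD _ _) _; rewrite [leRHS]splitr lerD//; last first.
  by apply: h2 => // r; have := xy r; rewrite le_min => /andP[].
rewrite normrM; apply: (@le_trans _ _ ((`|a| + 1) * (e / 2 / (`|a| + 1)))); last first.
  by rewrite mulrC divfK// gt_eqF.
apply: ler_pM => //; first by rewrite lerDl.
by apply: h1 => // r; have := xy r; rewrite le_min => /andP[].
Qed.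

Lemma box_regularM f g : box_regular f -> box_regular g ->
  box_regular (fun x => f x * g x).
Proof.
move=> [cf [Mf hf]] [cg [Mg hg]]; split; last first.
  by exists (Mf * Mg) => x bx; rewrite normrM ler_pM ?hf ?hg.
have [M [M0 hM]] : exists M, 0 < M /\ forall x, box x -> `|f x| <= M /\ `|g x| <= M.
  exists (`|Mf| + `|Mg| + 1); split; first by rewrite ltr_wpDl ?addr_ge0.
  move=> x bx; split.
    by apply: le_trans (hf _ bx) _; apply: le_trans (ler_norm _) _; have := normr_ge0 Mg; lra.
  by apply: le_trans (hg _ bx) _; apply: le_trans (ler_norm _) _; have := normr_ge0 Mf; lra.
move=> e e0; have e' : 0 < e / 2 / M by rewrite !divr_gt0.
have [d1 d10 h1] := cf _ e'; have [d2 d20 h2] := cg _ e'.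
exists (Num.min d1 d2) => [|x y bx byy xy]; first by rewrite lt_min d10.
have -> : f x * g x - f y * g y = f x * (g x - g y) + (f x - f y) * g y by ring.
apply: le_trans (ler_normD _ _) _; rewrite [leRHS]splitr lerD// normrM.
  apply: (@le_trans _ _ (M * (e / 2 / M))); last by rewrite mulrC divfK// gt_eqF.
  apply: ler_pM => //; first by case: (hM _ bx).
  by apply: h2 => // r; have := xy r; rewrite le_min => /andP[].
apply: (@le_trans _ _ ((e / 2 / M) * M)); last by rewrite divfK// gt_eqF.
apply: ler_pM => //; last by case: (hM _ byy).
by apply: h1 => // r; have := xy r; rewrite le_min => /andP[].
Qed.

Lemma box_regularD f g : box_regular f -> box_regular g ->
  box_regular (fun x => f x + g x).
Proof.
move=> hf hg; have := box_regular_lin 1 hf hg.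
by under eq_fun do rewrite mul1r.
Qed.

Lemma box_regularN f : box_regular f -> box_regular (fun x => - f x).
Proof.
move=> hf; have := box_regular_lin (-1) hf (box_regular_cst 0).
by under eq_fun do rewrite mulN1r addr0.
Qed.

Lemma box_regular_uniform f :
  (forall e : R, 0 < e -> exists2 g, box_regular g &
    forall x, box x -> `|f x - g x| <= e) -> box_regular f.
Proof.
move=> h; split; last first.
  have [g [_ [M hM]] fg] := h 1 ltr01.
  exists (1 + M) => x bx; rewrite -(subrK (g x) (f x)).
  by apply: le_trans (ler_normD _ _) _; rewrite lerD ?fg ?hM.
move=> e e0; have e30 : 0 < e / 3 by lra.
have [g [cg _] fg] := h _ e30; have [delta d0 hd] := cg _ e30.
exists delta => // x y bx byy xy.
have := fg _ bx; have := fg _ byy; have := hd _ _ bx byy xy.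
by rewrite !ler_norml; lra.
Qed.

End Closure.

Definition segment_ucont (F : R -> R) : Prop :=
  forall e : R, 0 < e -> exists2 delta : R, 0 < delta & forall s t,
    0 <= s <= tau -> 0 <= t <= tau -> `|s - t| <= delta -> `|F s - F t| <= e.

Lemma segment_ucont_integrable F : segment_ucont F ->
  lebesgue_measure.-integrable `[0%R, tau] (EFin \o F).
Proof.
move=> hF; apply: continuous_compact_integrable; first exact: segment_compact.
apply/subspace_continuousP => x /=; rewrite in_itv/= => xI.
apply/cvgrPdist_le => e /hF[delta d0 h].
rewrite near_withinE; apply/nbhs_ballP; exists delta => //= y xy.
by rewrite in_itv/= => yI; apply: h => //; exact: ltW.
Qed.

Lemma Rint_segment_cst c : \int[lebesgue_measure]_(t in `[0%R, tau]) c = tau * c.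
Proof.
rewrite Rintegral_cst//= lebesgue_measure_itv/= lte_fin two_pi_gt0.
by rewrite -EFinB subr0/= mulrC.
Qed.

Lemma Rint_segment_le F M : segment_ucont F ->
  (forall t, 0 <= t <= tau -> `|F t| <= M) ->
  `|\int[lebesgue_measure]_(t in `[0%R, tau]) F t| <= tau * M.
Proof.
move=> hF hM; apply: le_trans (le_normr_Rintegral _ (segment_ucont_integrable hF)) _ => //.
rewrite -Rint_segment_cst; apply: le_Rintegral => //.
- apply: (@segment_ucont_integrable (fun t => `|F t|)) => e /hF[delta d0 h].
  exists delta => // s t hs ht st; apply: le_trans (h _ _ hs ht st).
  by rewrite ler_dist_dist.
- by apply: (@segment_ucont_integrable (fun=> M)) => e e0; exists 1 => // *; rewrite subrr normr0 ltW.
Qed.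

Definition slice d (f : 'rV[R]_d.+1 -> R) (t : R) : 'rV[R]_d -> R :=
  fun y => f (row_mx (const_mx t : 'rV[R]_1) y).

Lemma row_mx_entry d (t : R) (y : 'rV[R]_d) (r : 'I_(1 + d)) :
  row_mx (const_mx t : 'rV[R]_1) y 0 r =
  match fintype.split r with inl _ => t | inr j => y 0 j end.
Proof. by rewrite mxE; case: fintype.split => // j; rewrite mxE. Qed.

Lemma box_row_mx d (t : R) (y : 'rV[R]_d) : 0 <= t <= tau -> box y ->
  box (row_mx (const_mx t : 'rV[R]_1) y : 'rV[R]_d.+1).
Proof. by move=> ht hy r; rewrite row_mx_entry; case: fintype.split. Qed.

Lemma slice_regular d (f : 'rV[R]_d.+1 -> R) t : 0 <= t <= tau ->
  box_regular f -> box_regular (slice f t).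
Proof.
move=> ht [cf [M hM]]; split; last first.
  by exists M => y hy; apply: hM; exact: box_row_mx.
move=> e e0; have [delta d0 h] := cf _ e0; exists delta => // x y bx byy xy.
apply: h; [exact: box_row_mx..|] => r.
by rewrite !row_mx_entry; case: fintype.split => // _; rewrite subrr normr0 ltW.
Qed.

(** One induction for both parts: in the first variable, the inner integral is
    integrable because it is uniformly continuous, and this follows from
    linearity and the bound, applied to the difference of two slices. *)
Lemma torus_integral_spec d :
  (forall (a : R) f g, box_regular f -> box_regular g ->
    torus_integral (fun x : 'rV[R]_d => a * f x + g x) =
    a * torus_integral f + torus_integral g) /\
  (forall f M, box_regular f -> (forall x, box x -> `|f x| <= M) ->
    `|torus_integral (f : 'rV[R]_d -> R)| <= tau ^+ d * M).
Proof.
elim: d => [|d [IHlin IHle]].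
  split => //= f M _ hM; rewrite expr0 mul1r; apply: hM => -[].
  by [].
have sl (f : 'rV[R]_d.+1 -> R) : box_regular f ->
    segment_ucont (fun t => torus_integral (slice f t)).
  move=> rf e e0; have tau0 : 0 < tau ^+ d by rewrite exprn_gt0 ?two_pi_gt0.
  have [delta d0 h] := rf.1 (e / tau ^+ d) (divr_gt0 e0 tau0).
  exists delta => // s t hs ht st.
  have -> : torus_integral (slice f s) - torus_integral (slice f t) =
      torus_integral (fun y => -1 * slice f t y + slice f s y).
    by rewrite (IHlin (-1) _ _ (slice_regular ht rf) (slice_regular hs rf)) mulN1r addrC.
  have -> : e = tau ^+ d * (e / tau ^+ d) by rewrite mulrC divfK// gt_eqF.
  apply: IHle => [|y hy]; first by apply: box_regular_lin; exact: slice_regular.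
  rewrite mulN1r addrC; apply: h; [exact: box_row_mx..|] => r.
  by rewrite !row_mx_entry; case: fintype.split => // j; rewrite subrr normr0 ltW.
split => [a f g rf rg|f M rf hM].
  rewrite /= -/two_pi.
  rewrite -RintegralZl//; last exact: (segment_ucont_integrable (sl _ rf)).
  rewrite -RintegralD//; last 2 first.
  - exact: (integrableZl _ a (segment_ucont_integrable (sl _ rf))).
  - exact: (segment_ucont_integrable (sl _ rg)).
  apply: eq_Rintegral => t /set_mem/=; rewrite in_itv/= => ht.
  by rewrite -(IHlin a _ _ (slice_regular ht rf) (slice_regular ht rg)).
rewrite /= -/two_pi exprS -mulrA; apply: Rint_segment_le; first exact: sl.
move=> t ht; apply: IHle; first exact: slice_regular.
by move=> y hy; apply: hM; exact: box_row_mx.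
Qed.

Lemma torus_integral_lin d (a : R) (f g : 'rV[R]_d -> R) :
  box_regular f -> box_regular g ->
  torus_integral (fun x => a * f x + g x) = a * torus_integral f + torus_integral g.
Proof. exact: (torus_integral_spec d).1. Qed.

Lemma torus_integral_le d (f : 'rV[R]_d -> R) M : box_regular f ->
  (forall x, box x -> `|f x| <= M) -> `|torus_integral f| <= tau ^+ d * M.
Proof. exact: (torus_integral_spec d).2. Qed.

End BoxContinuity.

(** * Trigonometric monomials *)

Section Trigonometric.
Context {R : realType}.
Local Notation tau := (@two_pi R).

Lemma periodic_int (f : R -> R) (T : R) (m : int) :
  periodic f T -> forall x, f (x + T * m%:~R) = f x.
Proof.
move=> fT x; case: m => n; first by rewrite mulr_natr periodicn.
rewrite NegzE mulrNz mulrN -(periodicn fT n.+1 (x - _)) -mulr_natr.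
by rewrite -[n.+1%:~R]/(n.+1%:R) subrK.
Qed.

Lemma two_piE : tau = pi *+ 2. Proof. by rewrite /two_pi mulr_natl. Qed.

Lemma cos_tau_int (m : int) (x : R) : cos (x + tau * m%:~R) = cos x.
Proof. by rewrite two_piE; apply: periodic_int; exact: cosD2pi. Qed.

Lemma sin_tau_int (m : int) (x : R) : sin (x + tau * m%:~R) = sin x.
Proof. by rewrite two_piE; apply: periodic_int; exact: sinD2pi. Qed.

Lemma is_derive_trig (a b m q t : R) :
  is_derive t 1 (fun s : R => a * cos (q + m * s) + b * sin (q + m * s))
    (m * (b * cos (q + m * t) - a * sin (q + m * t))).
Proof.
have hm : is_derive t 1 (fun s : R => q + m * s) m.
  have h := is_deriveD (is_derive_cst q t 1) (is_deriveZ m (is_derive_id t (1 : R))).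
  by apply: is_derive_eq h _; rewrite add0r /GRing.scale/= mulr1.
have hs : is_derive t 1 (fun s : R => sin (q + m * s)) (cos (q + m * t) * m).
  exact: (@is_derive1_comp R sin (fun s => q + m * s) t _ _ (is_derive_sin _) hm).
have hc : is_derive t 1 (fun s : R => cos (q + m * s)) (- sin (q + m * t) * m).
  exact: (@is_derive1_comp R cos (fun s => q + m * s) t _ _ (is_derive_cos _) hm).
have h := is_deriveD (is_deriveZ a hc) (is_deriveZ b hs).
by apply: is_derive_eq h _; rewrite /GRing.scale/=; ring.
Qed.

Lemma continuous_trig1 (a b m : R) :
  continuous (fun t : R => a * cos (m * t) + b * sin (m * t) : R).
Proof.
move=> t; apply/differentiable_continuous/derivable1_diffP.
have := is_derive_trig a b m 0 t.
by under eq_fun do rewrite !add0r; case.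
Qed.

(** For m <> 0 the integrand has a periodic primitive. *)
Lemma Rint_trig (a b : R) (m : int) :
  \int[lebesgue_measure]_(t in `[0%R, tau]) (a * cos (m%:~R * t) + b * sin (m%:~R * t)) =
  if m == 0 then tau * a else 0.
Proof.
case: eqP => [->|/eqP m0].
  under eq_Rintegral do rewrite mul0r cos0 sin0 mulr1 mulr0 addr0.
  exact: Rint_segment_cst.
have mR0 : m%:~R != 0 :> R by rewrite intr_eq0.
pose F (t : R) : R := (- b / m%:~R) * cos (0 + m%:~R * t) + (a / m%:~R) * sin (0 + m%:~R * t).
have dF (t : R) : is_derive t 1 F (a * cos (m%:~R * t) + b * sin (m%:~R * t)).
  apply: is_derive_eq (is_derive_trig _ _ _ _ _) _.
  by rewrite !add0r; field.
have cF : continuous F.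
  move=> t; by apply/differentiable_continuous/derivable1_diffP; exact: ex_derive.
rewrite /Rintegral (@continuous_FTC2 _ _ F) ?two_pi_gt0//; last 3 first.
- exact/continuous_subspaceT/continuous_trig1.
- split; first by move=> t _; exact: ex_derive.
    by apply: cvg_at_right_filter; exact: cF.
  by apply: cvg_at_left_filter; exact: cF.
- by move=> t _; rewrite derive1E derive_val.
rewrite /= /F mulr0 !addr0 [m%:~R * _]mulrC cos_tau_int sin_tau_int; ring.
Qed.

Variable d : nat.
Implicit Types (k : 'rV[int]_d) (x : 'rV[R]_d).

(** The span of cos(k.x) and sin(k.x) is stable under partial derivatives and
    under fixing the first variable, so that inductions over derivatives and
    over the dimension stay inside it. *)
Definition trig (a b : R) k x : R := a * cos (phase k x) + b * sin (phase k x).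

Lemma phaseDr k x y : phase k (x + y) = phase k x + phase k y :> R.
Proof. by rewrite /phase -big_split/=; apply: eq_bigr => r _; rewrite mxE mulrDr. Qed.

Lemma phaseDl k k' x : phase (k + k') x = phase k x + phase k' x :> R.
Proof. by rewrite /phase -big_split/=; apply: eq_bigr => r _; rewrite mxE rmorphD mulrDl. Qed.

Lemma phaseNl k x : phase (- k) x = - phase k x :> R.
Proof. by rewrite /phase -sumrN; apply: eq_bigr => r _; rewrite mxE rmorphN mulNr. Qed.

Lemma phaseZr k (c : R) x : phase k (c *: x) = c * phase k x :> R.
Proof. by rewrite /phase mulr_sumr; apply: eq_bigr => r _; rewrite mxE mulrCA. Qed.

Lemma phase_delta k r : phase k (delta_mx 0 r) = (k 0 r)%:~R :> R.
Proof.
rewrite /phase (bigD1 r)//= big1 ?addr0 => [|s sr].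
  by rewrite mxE !eqxx mulr1.
by rewrite mxE (negbTE sr) andbF mulr0.
Qed.

Lemma phase_torus k (j : 'rV[int]_d) :
  exists m : int, phase k (\row_r (2 * pi * (j 0 r)%:~R)) = tau * m%:~R :> R.
Proof.
exists (\sum_(r < d) k 0 r * j 0 r).
rewrite /phase rmorph_sum mulr_sumr; apply: eq_bigr => r _.
by rewrite mxE rmorphM/= mulrCA.
Qed.

Lemma differentiable_phase k x : differentiable (phase k : 'rV[R]_d -> R) x.
Proof.
pose f (r : 'I_d) (y : 'rV[R]_d) : R := (k 0 r)%:~R * y 0 r.
have -> : (phase k : 'rV[R]_d -> R) = \sum_(r < d) f r.
  by apply/funext => y; rewrite fct_sumE.
apply: (@differentiable_sum R 'rV[R]_d R d f x) => r.
exact: (differentiableZ _ (differentiable_coord x 0 r)).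
Qed.

Lemma differentiable_trig a b k x : differentiable (trig a b k) x.
Proof.
apply: differentiableD; apply: differentiableZ.
  apply: (differentiable_comp (differentiable_phase k x)).
  by apply/derivable1_diffP; exact: derivable_cos.
apply: (differentiable_comp (differentiable_phase k x)).
by apply/derivable1_diffP; exact: derivable_sin.
Qed.

(** Along a coordinate direction only one real variable moves, and it changes
    the phase with speed k_r. *)
Lemma partial_trig a b k r :
  partial r (trig a b k) = trig ((k 0 r)%:~R * b) (- (k 0 r)%:~R * a) k.
Proof.
apply/funext => x; rewrite /partial.
pose g (h : R) := a * cos (phase k x + (k 0 r)%:~R * h) +
  b * sin (phase k x + (k 0 r)%:~R * h).
have -> : 'D_(delta_mx 0 r) (trig a b k) x = 'D_1 g 0.
  rewrite /derive; set u := fun h => _; set v := fun h => _.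
  have -> // : u = v.
  apply/funext => h; rewrite {}/u {}/v /=.
  rewrite /trig phaseDr phaseZr phase_delta /g addr0 mulr0 addr0.
  by rewrite /GRing.scale/= mulr1 [h * (k 0 r)%:~R]mulrC [_ * h + phase k x]addrC.
have := @derive_val _ _ _ _ _ _ _ (is_derive_trig a b (k 0 r)%:~R (phase k x) 0).
by move=> ->; rewrite mulr0 addr0 /trig; ring.
Qed.

Lemma test_function_trig a b k : test_function (trig a b k).
Proof.
split => [j x|s].
  rewrite /trig phaseDr; have [m ->] := phase_torus k j.
  by rewrite cos_tau_int sin_tau_int.
have [a' [b' ->]] : exists a' b', partials s (trig a b k) = trig a' b' k.
  elim: s => [|r s [a' [b' IH]]]; first by exists a, b.
  by exists ((k 0 r)%:~R * b'), (- (k 0 r)%:~R * a'); rewrite /= IH partial_trig.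
exact: differentiable_trig.
Qed.

Lemma test_function_box_regular (f : 'rV[R]_d -> R) : test_function f -> box_regular f.
Proof.
move=> [_ /(_ [::])/= h]; apply: continuous_box_regular => x.
exact: differentiable_continuous.
Qed.

Lemma trig_box_regular a b k : box_regular (trig a b k).
Proof. exact/test_function_box_regular/test_function_trig. Qed.

End Trigonometric.

Section Orthogonality.
Context {R : realType}.
Local Notation tau := (@two_pi R).

Lemma phase_row_mx d (k : 'rV[int]_d.+1) (t : R) (y : 'rV[R]_d) :
  phase k (row_mx (const_mx t : 'rV[R]_1) y : 'rV[R]_d.+1) =
  (k 0 0)%:~R * t + phase (rsubmx (k : 'rV[int]_(1 + d))) y.
Proof.
rewrite /phase (@big_split_ord _ _ _ 1 d)/= big_ord1; congr (_ * _ + _).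
- by congr (k 0 _)%:~R; exact: val_inj.
- by apply: etrans (@row_mxEl R 1 1 d _ y 0 0) _; rewrite mxE.
- apply: eq_bigr => r _; rewrite [in RHS]mxE; congr (_ * _).
  exact: (@row_mxEr R 1 1 d _ y 0 r).
Qed.

Lemma slice_trig d (a b : R) (k : 'rV[int]_d.+1) (t : R) :
  slice (trig a b k) t =
  trig (a * cos ((k 0 0)%:~R * t) + b * sin ((k 0 0)%:~R * t))
       (b * cos ((k 0 0)%:~R * t) - a * sin ((k 0 0)%:~R * t))
       (rsubmx (k : 'rV[int]_(1 + d))).
Proof.
apply/funext => y; rewrite /slice /trig phase_row_mx cosD sinD; ring.
Qed.

Lemma torus_integral_trig d (a b : R) (k : 'rV[int]_d) :
  torus_integral (trig a b k) = if k == 0 then tau ^+ d * a else 0.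
Proof.
elim: d a b k => [|d IH] a b k.
  rewrite /= [k]thinmx0 eqxx /trig /phase big_ord0 cos0 sin0; ring.
have E : (k == 0) = (k 0 0 == 0) && (rsubmx (k : 'rV[int]_(1 + d)) == 0).
  apply/eqP/andP => [->|[/eqP k0 /eqP k1]].
    by split; apply/eqP; [rewrite mxE|apply/rowP => r; rewrite !mxE].
  apply/rowP => r; rewrite mxE.
  have [j ->|->//] := unliftP 0 r.
  by have := congr1 (fun v : 'rV[int]_d => v 0 j) k1; rewrite !mxE => <-; congr (k 0 _); exact: val_inj.
rewrite /=; under eq_Rintegral => t _ do rewrite -/(slice _ t) slice_trig IH.
rewrite E; case: (rsubmx _ == 0); rewrite ?andbT ?andbF; last first.
  by rewrite [LHS]Rint_segment_cst mulr0.
rewrite RintegralZl//; last first.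
  apply: continuous_compact_integrable; first exact: segment_compact.
  exact/continuous_subspaceT/continuous_trig1.
by rewrite [X in _ * X]Rint_trig; case: eqP; rewrite ?mulr0// exprS mulrCA mulrA.
Qed.

End Orthogonality.

(** * Fourier coefficients of products *)

Section ComplexIntegral.
Context {R : realType} {d : nat}.
Local Notation tau := (@two_pi R).
Implicit Types (f g : 'rV[R]_d -> R[i]) (k h l : 'rV[int]_d) (x : 'rV[R]_d).

Definition cregular f : Prop :=
  box_regular (fun x => Re (f x)) /\ box_regular (fun x => Im (f x)).

Definition ctorus_integral f : R[i] :=
  torus_integral (fun x => Re (f x)) +i* torus_integral (fun x => Im (f x)).

Lemma cregular_cst (c : R[i]) : cregular (fun=> c).
Proof. by split; exact: box_regular_cst. Qed.

Lemma ReM (z w : R[i]) : Re (z * w) = Re z * Re w - Im z * Im w.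
Proof. by case: z w => ? ? []. Qed.

Lemma ImM (z w : R[i]) : Im (z * w) = Re z * Im w + Im z * Re w.
Proof. by case: z w => ? ? [] ? ? /=; rewrite addrC. Qed.

Lemma cregularD f g : cregular f -> cregular g -> cregular (fun x => f x + g x).
Proof.
move=> [f1 f2] [g1 g2]; split.
  by under eq_fun do rewrite ReD; exact: box_regularD.
by under eq_fun do rewrite ImD; exact: box_regularD.
Qed.

Lemma cregularM f g : cregular f -> cregular g -> cregular (fun x => f x * g x).
Proof.
move=> [f1 f2] [g1 g2]; split.
  under eq_fun do rewrite ReM.
  by apply: box_regularD; [|apply: box_regularN]; exact: box_regularM.
by under eq_fun do rewrite ImM; apply: box_regularD; exact: box_regularM.
Qed.

Lemma cregular_lin (z : R[i]) f g : cregular f -> cregular g ->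
  cregular (fun x => z * f x + g x).
Proof.
by move=> rf rg; apply: cregularD => //; apply: cregularM => //; exact: cregular_cst.
Qed.

Lemma cregular_sum (I : Type) (s : seq I) (F : I -> 'rV[R]_d -> R[i]) :
  (forall i, cregular (F i)) -> cregular (fun x => \sum_(i <- s) F i x).
Proof.
move=> h; elim: s => [|i s IH].
  by under eq_fun do rewrite big_nil; exact: cregular_cst.
by under eq_fun do rewrite big_cons; exact: cregularD.
Qed.

Lemma cregular_bounded f : cregular f ->
  exists2 M : R, 0 < M & forall x, box x -> normc (f x) <= M.
Proof.
move=> [[_ [M1 h1]] [_ [M2 h2]]]; exists (`|M1| + `|M2| + 1).
  by rewrite ltr_wpDl ?addr_ge0.
move=> x bx; apply: le_trans (normc_le_ReIm _) _.
have := le_trans (h1 _ bx) (ler_norm _); have := le_trans (h2 _ bx) (ler_norm _); lra.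
Qed.

Lemma ctorus_integral_lin (z : R[i]) f g : cregular f -> cregular g ->
  ctorus_integral (fun x => z * f x + g x) = z * ctorus_integral f + ctorus_integral g.
Proof.
move=> [f1 f2] [g1 g2]; rewrite /ctorus_integral.
under [in X in X +i* _]eq_fun do rewrite ReD ReM -addrA -mulNr.
under [in X in _ +i* X]eq_fun do rewrite ImD ImM -addrA.
rewrite (torus_integral_lin _ f1 (box_regular_lin (- Im z) f2 g1)).
rewrite (torus_integral_lin _ f2 (box_regular_lin (Im z) f1 g2)).
rewrite (torus_integral_lin _ f2 g1) (torus_integral_lin _ f1 g2).
by case: z => a b; apply/eqP; rewrite eq_complex/=; apply/andP; split; apply/eqP; ring.
Qed.

Lemma ctorus_integral0 : ctorus_integral (fun=> 0) = 0.
Proof.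
have h := cregular_cst 0.
have := ctorus_integral_lin 1 h h; rewrite mul1r addr0 mul1r => /eqP.
by rewrite -subr_eq0 opprD addrA subrr sub0r oppr_eq0 => /eqP.
Qed.

Lemma ctorus_integralZ (z : R[i]) f : cregular f ->
  ctorus_integral (fun x => z * f x) = z * ctorus_integral f.
Proof.
move=> rf; have := ctorus_integral_lin z rf (cregular_cst 0).
by under eq_fun do rewrite addr0; rewrite ctorus_integral0 addr0.
Qed.

Lemma ctorus_integral_sum (I : Type) (s : seq I) (z : I -> R[i])
    (F : I -> 'rV[R]_d -> R[i]) : (forall i, cregular (F i)) ->
  ctorus_integral (fun x => \sum_(i <- s) z i * F i x) =
  \sum_(i <- s) z i * ctorus_integral (F i).
Proof.
move=> rF; elim: s => [|i s IH].
  by under eq_fun do rewrite big_nil; rewrite big_nil ctorus_integral0.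
under eq_fun do rewrite big_cons.
rewrite big_cons ctorus_integral_lin// ?IH//.
by apply: cregular_sum => j; apply: cregularM => //; exact: cregular_cst.
Qed.

Lemma ctorus_integral_le f M : cregular f -> (forall x, box x -> normc (f x) <= M) ->
  normc (ctorus_integral f) <= 2 * tau ^+ d * M.
Proof.
move=> [f1 f2] hM; apply: le_trans (normc_le_ReIm _) _.
rewrite /= -mulrA [2 * _]mulr_natl mulr2n.
by apply: lerD; apply: torus_integral_le => // x bx; apply: le_trans (hM _ bx);
  [exact: normr_Re|exact: normr_Im].
Qed.

Definition basis_scale : R := ((2 * pi) `^ (d%:R / 2))^-1.
Local Notation kappa := basis_scale.

Lemma basis_scale_gt0 : 0 < kappa.
Proof. by rewrite invr_gt0 powR_gt0// two_pi_gt0. Qed.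

(** The normalisation of the basis: the torus has measure (2 pi)^d. *)
Lemma basis_scale_sqr : kappa ^+ 2 * tau ^+ d = 1.
Proof.
have -> : basis_scale ^+ 2 = (tau ^+ d)^-1.
  rewrite /basis_scale exprVn -(@powR_mulrn _ (_ `^ _) 2) ?powR_ge0//.
  by rewrite -powRrM divfK// powR_mulrn// ltW// two_pi_gt0.
by rewrite mulVf// gt_eqF// exprn_gt0// two_pi_gt0.
Qed.

Lemma Re_fourier_basis k : (fun x => Re (fourier_basis k x)) = trig kappa 0 k.
Proof. by apply/funext => x; rewrite /fourier_basis ReM /trig/= !mul0r subr0 addr0. Qed.

Lemma Im_fourier_basis k : (fun x => Im (fourier_basis k x)) = trig 0 kappa k.
Proof. by apply/funext => x; rewrite /fourier_basis ImM /trig/= !mul0r add0r addr0. Qed.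

Lemma cregular_fourier_basis k : cregular (fourier_basis k).
Proof.
by split; rewrite ?Re_fourier_basis ?Im_fourier_basis; exact: trig_box_regular.
Qed.

Lemma conj_fourier_basis k x : conjc (fourier_basis k x) = fourier_basis (- k) x.
Proof.
by rewrite /fourier_basis conjcM conjc_real phaseNl cosN sinN.
Qed.

Lemma normc_fourier_basis k x : normc (fourier_basis k x) = kappa.
Proof.
rewrite /fourier_basis ComplexField.Normc.normcM normcR/= cos2Dsin2 sqrtr1 mulr1.
by rewrite ger0_norm// ltW// basis_scale_gt0.
Qed.

Lemma fourier_basisM h l x :
  fourier_basis h x * fourier_basis l x = kappa%:C * fourier_basis (h + l) x.
Proof.
rewrite /fourier_basis mulrACA [RHS]mulrA; congr (_ * _).
rewrite phaseDl cosD sinD.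
by apply/eqP; rewrite eq_complex/=; apply/andP; split; apply/eqP; ring.
Qed.

Lemma ctorus_integral_fourier_basis k :
  ctorus_integral (fourier_basis k) = if k == 0 then (tau ^+ d * kappa)%:C else 0.
Proof.
rewrite /ctorus_integral Re_fourier_basis Im_fourier_basis !torus_integral_trig.
by case: eqP => // _; rewrite mulr0.
Qed.

Lemma fourier_orthonormal h k :
  ctorus_integral (fun x => fourier_basis h x * fourier_basis (- k) x) = (h == k)%:R.
Proof.
under eq_fun do rewrite fourier_basisM.
rewrite ctorus_integralZ; last exact: cregular_fourier_basis.
rewrite ctorus_integral_fourier_basis subr_eq0; case: eqP => _; last by rewrite mulr0.
by rewrite -rmorphM/= mulrCA -expr2 mulrC basis_scale_sqr.
Qed.

Lemma fourier_triple h l k :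
  ctorus_integral (fun x => fourier_basis l x * (fourier_basis h x * fourier_basis (- k) x)) =
  kappa%:C * (l == k - h)%:R.
Proof.
have -> : (fun x => fourier_basis l x * (fourier_basis h x * fourier_basis (- k) x)) =
  (fun x => kappa%:C * (fourier_basis l x * fourier_basis (- (k - h)) x)).
  by apply/funext => x; rewrite fourier_basisM opprB mulrCA.
rewrite ctorus_integralZ ?fourier_orthonormal//.
by apply: cregularM; exact: cregular_fourier_basis.
Qed.

Section FourierSeries.
Variables (a : 'rV[int]_d -> R[i]) (M : R) (f : 'rV[R]_d -> R[i]).
Hypothesis aM : sum_le (fun h => normc (a h)) M.
Hypothesis af : forall x, has_sum (fun h => a h * fourier_basis h x) (f x).

Let dominated h x : normc (a h * fourier_basis h x) <= kappa * normc (a h).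
Proof. by rewrite ComplexField.Normc.normcM normc_fourier_basis mulrC. Qed.

Let dom_ge0 h : 0 <= kappa * normc (a h).
Proof. by rewrite mulr_ge0 ?normc_ge0// ltW// basis_scale_gt0. Qed.

Let dom_sum : sum_le (fun h => kappa * normc (a h)) (kappa * M).
Proof. by apply: sum_leZ => //; rewrite ltW// basis_scale_gt0. Qed.

Let partial_regular (F : {fset 'rV[int]_d}) :
  cregular (fun x => \sum_(h <- F) a h * fourier_basis h x).
Proof.
apply: cregular_sum => h; apply: cregularM; first exact: cregular_cst.
exact: cregular_fourier_basis.
Qed.

Lemma fourier_series_regular : cregular f.
Proof.
split; apply: box_regular_uniform => e e0;
  have [F0 hF0] := has_sum_dominated_uniform dom_ge0 dom_sum e0.
- exists (fun x => Re (\sum_(h <- F0) a h * fourier_basis h x)).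
    exact: (partial_regular F0).1.
  move=> x _; rewrite -ReN -ReD; apply: le_trans (normr_Re _) _.
  by rewrite normcB; apply: hF0 => //; exact: af.
- exists (fun x => Im (\sum_(h <- F0) a h * fourier_basis h x)).
    exact: (partial_regular F0).2.
  move=> x _; rewrite -ImN -ImD; apply: le_trans (normr_Im _) _.
  by rewrite normcB; apply: hF0 => //; exact: af.
Qed.

(** Uniform convergence lets the series be integrated term by term against any
    regular function. *)
Lemma has_sum_ctorus_integral g : cregular g ->
  has_sum (fun h => a h * ctorus_integral (fun x => fourier_basis h x * g x))
          (ctorus_integral (fun x => f x * g x)).
Proof.
move=> rg; have [Mg Mg0 hMg] := cregular_bounded rg.
have tau0 : 0 < 2 * tau ^+ d by rewrite mulr_gt0// exprn_gt0// two_pi_gt0.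
move=> e e0; have e'0 : 0 < e / (2 * tau ^+ d) / Mg by rewrite !divr_gt0.
have [F0 hF0] := has_sum_dominated_uniform dom_ge0 dom_sum e'0.
exists F0 => F F0F.
have rfg : cregular (fun x => f x * g x).
  by apply: cregularM => //; exact: fourier_series_regular.
have rb h : cregular (fun x => fourier_basis h x * g x).
  by apply: cregularM => //; exact: cregular_fourier_basis.
have rs : cregular (fun x => \sum_(h <- F) a h * (fourier_basis h x * g x)).
  by apply: cregular_sum => h; apply: cregularM => //; exact: cregular_cst.
rewrite -ctorus_integral_sum//.
rewrite addrC -mulN1r -ctorus_integral_lin//.
have -> : e = 2 * tau ^+ d * (e / (2 * tau ^+ d)) by rewrite mulrC divfK// gt_eqF.
apply: ctorus_integral_le; first exact: cregular_lin.
move=> x bx.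
have -> : -1 * (f x * g x) + \sum_(h <- F) a h * (fourier_basis h x * g x) =
  (\sum_(h <- F) a h * fourier_basis h x - f x) * g x.
  rewrite mulrBl mulr_suml mulN1r addrC; congr (_ + _).
  by apply: eq_bigr => h _; rewrite mulrA.
rewrite ComplexField.Normc.normcM -[leRHS](divfK (lt0r_neq0 Mg0) (e / (2 * tau ^+ d))).
apply: ler_pM; rewrite ?normc_ge0//; last exact: hMg.
by apply: hF0 => //; exact: af.
Qed.

Lemma has_sum_single (I : choiceType) (i : I) (c : R[i]) :
  has_sum (fun j => c * (j == i)%:R) c.
Proof.
move=> e e0; exists [fset i]%fset => F; rewrite fsub1set => iF.
rewrite (big_fsetD1 i)//= eqxx mulr1 big_seq big1 ?addr0 ?subrr.
  by rewrite ComplexField.Normc.normc0 ltW.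
by move=> j; rewrite in_fsetD1 => /andP[/negbTE -> _]; rewrite mulr0.
Qed.

Lemma fourier_series_coef k :
  ctorus_integral (fun x => f x * fourier_basis (- k) x) = a k.
Proof.
have := has_sum_ctorus_integral (cregular_fourier_basis (- k)).
under eq_fun do rewrite fourier_orthonormal.
have -> : (fun h => a h * (h == k)%:R) = (fun h => a k * (h == k)%:R).
  by apply/funext => h; case: eqP => [->//|_]; rewrite !mulr0.
by move/has_sum_unique; apply; exact: has_sum_single.
Qed.

Lemma fourier_series_coef2 h k :
  ctorus_integral (fun x => f x * (fourier_basis h x * fourier_basis (- k) x)) =
  kappa%:C * a (k - h).
Proof.
have := has_sum_ctorus_integral
  (cregularM (cregular_fourier_basis h) (cregular_fourier_basis (- k))).
under eq_fun do rewrite fourier_triple.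
have -> : (fun l => a l * (kappa%:C * (l == k - h)%:R)) =
    (fun l => kappa%:C * a (k - h) * (l == k - h)%:R).
  by apply/funext => l; case: eqP => [->|_]; rewrite ?mulr0// !mulr1 mulrC.
by move/has_sum_unique; apply; exact: has_sum_single.
Qed.

End FourierSeries.

(** Both series are integrated term by term; orthonormality leaves, for each
    [h], the single coefficient of [g] with index [k - h]. *)
Lemma fourier_product_coef (a b : 'rV[int]_d -> R[i]) (A B : R) f g k :
  sum_le (fun h => normc (a h)) A -> sum_le (fun h => normc (b h)) B ->
  (forall x, has_sum (fun h => a h * fourier_basis h x) (f x)) ->
  (forall x, has_sum (fun h => b h * fourier_basis h x) (g x)) ->
  has_sum (fun h => kappa%:C * (a h * b (k - h)))
    (ctorus_integral (fun x => f x * g x * fourier_basis (- k) x)).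
Proof.
move=> hA hB hf hg.
have rg := fourier_series_regular hB hg.
have := has_sum_ctorus_integral hA hf (cregularM rg (cregular_fourier_basis (- k))).
under eq_fun => h.
  under eq_fun => x do rewrite mulrCA.
  rewrite (fourier_series_coef2 hB hg) mulrCA.
  over.
by under [X in has_sum _ (ctorus_integral X) -> _]eq_fun do rewrite mulrA.
Qed.

End ComplexIntegral.

(** * Fourier coefficients of distributions *)

Section DistributionCoefficients.
Context {R : realType} {d : nat}.
Local Notation tau := (@two_pi R).
Local Notation kappa := (@basis_scale R d).
Implicit Types (u : functional R d) (k h : 'rV[int]_d) (x : 'rV[R]_d).

(** Distributions are linear on test functions only, so the values at a
    frequency [k] are reduced to those of cos(k.x) and sin(k.x) once and for
    all. *)
Lemma distribution_trig u a b k : is_distribution u ->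
  u (trig a b k) = a * u (trig 1 0 k) + b * u (trig 0 1 k).
Proof.
move=> [lin _].
have t a' b' := @test_function_trig R d a' b' k.
have u0 : u (trig 0 0 k) = 0.
  have := lin 1 _ _ (t 0 0) (t 0 0).
  have -> : (fun x => 1 * trig 0 0 k x + trig 0 0 k x) = trig 0 0 k.
    by apply/funext => x; rewrite /trig; ring.
  by move=> /eqP; rewrite mul1r -subr_eq0 opprD addrA subrr sub0r oppr_eq0 => /eqP.
have -> : trig a b k = (fun x => a * trig 1 0 k x + trig 0 b k x).
  by apply/funext => x; rewrite /trig; ring.
rewrite (lin a _ _ (t 1 0) (t 0 b)); congr (_ + _).
have {1}-> : trig 0 b k = (fun x => b * trig 0 1 k x + trig 0 0 k x).
  by apply/funext => x; rewrite /trig; ring.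
by rewrite (lin b _ _ (t 0 1) (t 0 0)) u0 addr0.
Qed.

Lemma conj_basis_trig k :
  ((fun x => Re (conjc (fourier_basis k x))) = trig kappa 0 k) *
  ((fun x => Im (conjc (fourier_basis k x))) = trig 0 (- kappa) k).
Proof.
split; apply/funext => x; rewrite /fourier_basis conjcM conjc_real.
  by rewrite ReM /trig /basis_scale/=; ring.
by rewrite ImM /trig /basis_scale/=; ring.
Qed.

Lemma coefE u k : is_distribution u ->
  coef u k = kappa * u (trig 1 0 k) -i* (kappa * u (trig 0 1 k)).
Proof.
move=> du; rewrite /coef /cpairing !conj_basis_trig.
rewrite (distribution_trig kappa 0 k du) (distribution_trig 0 (- kappa) k du).
by rewrite !mul0r addr0 add0r mulNr.
Qed.

Lemma coefN u k : is_distribution u -> coef u (- k) = conjc (coef u k).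
Proof.
move=> du; rewrite !coefE//= opprK.
have -> : trig 1 0 (- k) = trig 1 0 k :> ('rV[R]_d -> R).
  by apply/funext => x; rewrite /trig phaseNl cosN !mul0r.
have -> : trig 0 1 (- k) = trig 0 (-1) k :> ('rV[R]_d -> R).
  by apply/funext => x; rewrite /trig phaseNl sinN !mul0r mul1r mulN1r.
by rewrite (distribution_trig 0 (-1) k du) mul0r add0r mulN1r mulrN opprK.
Qed.

Lemma coef_dpartial u r k : is_distribution u ->
  coef (dpartial r u) k = 'i%C * (k 0 r)%:~R * coef u k.
Proof.
move=> du; rewrite [in RHS]coefE// /coef /cpairing !conj_basis_trig /dpartial.
rewrite !partial_trig mulr0 mulr0 intc_real.
rewrite (distribution_trig 0 (- (k 0 r)%:~R * kappa) k du).
rewrite (distribution_trig ((k 0 r)%:~R * - kappa) 0 k du).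
by apply/eqP; rewrite eq_complex/=; apply/andP; split; apply/eqP; ring.
Qed.

Lemma vcoefN (v : vfunctional R d) k : is_vdistribution v ->
  vcoef v (- k) = conjv (vcoef v k).
Proof. by move=> dv; apply/rowP => s; rewrite !mxE coefN. Qed.

(** Complex conjugation together with k -> -k maps the series to itself. *)
Lemma has_sum_real_series (a : 'rV[int]_d -> R[i]) (M : R) x :
  (forall k, a (- k) = conjc (a k)) -> sum_le (fun k => normc (a k)) M ->
  has_sum (fun k => a k * fourier_basis k x)
    (Re (csum setT (fun k => a k * fourier_basis k x)))%:C.
Proof.
move=> aN aM; set S := csum _ _.
have h : has_sum (fun k => a k * fourier_basis k x) S.
  apply: (@has_sum_csum _ _ _ _ (kappa * M)) => [k []//|].
  apply: sum_le_mono (sum_leZ (ltW (basis_scale_gt0 (d := d))) aM) => k.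
  by rewrite ComplexField.Normc.normcM normc_fourier_basis mulrC.
suff <- : S = (Re S)%:C by [].
apply: eq_conj_Im0.
have h' := has_sum_reindex (@opprK _) (@opprK _) (has_sum_conj h).
apply: has_sum_unique h' _; congr (has_sum _ _): h; apply/funext => k /=.
by rewrite conjcM aN conjcK conj_fourier_basis opprK.
Qed.

Lemma has_sum_dfun u M x : is_distribution u ->
  sum_le (fun k => normc (coef u k)) M ->
  has_sum (fun k => coef u k * fourier_basis k x) (dfun u x)%:C.
Proof. by move=> du hM; apply: has_sum_real_series hM => k; exact: coefN. Qed.

Lemma has_sum_dfun_dpartial u r M x : is_distribution u ->
  sum_le (fun k => normc (coef (dpartial r u) k)) M ->
  has_sum (fun k => coef (dpartial r u) k * fourier_basis k x) (dfun (dpartial r u) x)%:C.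
Proof.
move=> du hM; apply: has_sum_real_series hM => k.
rewrite !coef_dpartial// coefN// conjcM mxE; congr (_ * _).
rewrite !intc_real rmorphN.
by apply/eqP; rewrite eq_complex/=; apply/andP; split; apply/eqP; ring.
Qed.

Lemma coef_regular (g : 'rV[R]_d -> R) k :
  coef (regular g) k = ctorus_integral (fun x => (g x)%:C * fourier_basis (- k) x).
Proof.
rewrite /coef /cpairing /regular /ctorus_integral.
congr (_ +i* _); congr torus_integral; apply/funext => x.
  by rewrite ReM conj_fourier_basis mul0r subr0.
by rewrite ImM conj_fourier_basis mul0r addr0.
Qed.

Lemma regular_distribution (g : 'rV[R]_d -> R) : box_regular g ->
  is_distribution (regular g).
Proof.
move=> rg; split.
- move=> a f f' /test_function_box_regular rf /test_function_box_regular rf'.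
  rewrite /regular -torus_integral_lin; [|exact: box_regularM..].
  by congr torus_integral; apply/funext => x; ring.
- have [M hM] := rg.2; exists (tau ^+ d * M), 0%N => f tf K hK.
  rewrite /regular -mulrA; apply: torus_integral_le.
    by apply: box_regularM => //; exact: test_function_box_regular.
  move=> x bx; rewrite normrM ler_pM ?hM//; exact: (hK [::]).
Qed.

(** The projection keeps the coefficients Hermitian and absolutely summable, so
    the projected series sums to a real function, and integration against it is
    a distribution with the projected coefficients. This witness is what the
    choice in [leray] needs. *)
Lemma leray_spec (u : vfunctional R d) M :
  (forall k, vcoef u (- k) = conjv (vcoef u k)) ->
  sum_le (fun k => cnorm (vcoef u k)) M ->
  is_vdistribution (leray u) /\
  forall k, vcoef (leray u) k = leray_symbol k (vcoef u k).
Proof.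
move=> uN uM; rewrite /leray.
pose a s k := leray_symbol k (vcoef u k) 0 s.
have aN s k : a s (- k) = conjc (a s k).
  by rewrite /a uN leray_symbolN -conjv_leray mxE.
have aM s : sum_le (fun k => normc (a s k)) M.
  apply: sum_le_mono uM => k; apply: le_trans (normc_entry _ _) _.
  exact: cnorm_leray.
pose g s x := Re (csum setT (fun k => a s k * fourier_basis k x)).
have gs s x : has_sum (fun k => a s k * fourier_basis k x) (g s x)%:C.
  exact: has_sum_real_series (aN s) (aM s).
pose z : vfunctional R d := fun s => regular (g s).
apply: (@xgetPex _ (fun _ _ => 0) [set z : vfunctional R d | is_vdistribution z /\
  forall k, vcoef z k = leray_symbol k (vcoef u k)]).
exists z; split => [s|k].
  apply: regular_distribution; exact: (fourier_series_regular (aM s) (gs s)).1.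
apply/rowP => s; rewrite !mxE coef_regular.
exact: (fourier_series_coef (aM s) (gs s)).
Qed.

Section Advection.
Variables v w : vfunctional R d.
Hypotheses (dv : is_vdistribution v) (dw : is_vdistribution w).
Variables Mv Mw : R.
Hypothesis hv : sum_le (fun k => cnorm (vcoef v k)) Mv.
Hypothesis hw : sum_le (fun k => knorm k * cnorm (vcoef w k)) Mw.

(** The interaction of the modes [h] of [v] and [l] of [w]. *)
Definition mode_product h l : 'rV[R[i]]_d :=
  (kappa%:C * 'i%C * dot (vcoef v h) (cvec l)) *: vcoef w l.

Lemma coef_sum_le s : sum_le (fun k => normc (coef (v s) k)) Mv.
Proof.
apply: sum_le_mono hv => k; apply: le_trans (normc_entry (vcoef v k) s).
by rewrite mxE.
Qed.

Lemma coef_dpartial_sum_le r s : sum_le (fun k => normc (coef (dpartial r (w s)) k)) Mw.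
Proof.
apply: sum_le_mono hw => k; rewrite coef_dpartial// !ComplexField.Normc.normcM.
have -> : normc 'i%C = 1 :> R by rewrite /= expr0n/= add0r expr1n sqrtr1.
rewrite mul1r intc_real normcR; apply: ler_pM; rewrite ?normc_ge0//.
  exact: knorm_entry.
by apply: le_trans (normc_entry (vcoef w k) s); rewrite mxE.
Qed.

(** Both factors of each product v_r (d_r w_s) are absolutely convergent series,
    whose coefficients convolve; the factor i (k - h)_r from the derivative
    combines over [r] to the scalar product of v_h and k - h. *)
Lemma has_sum_advection k s :
  has_sum (fun h => mode_product h (k - h) 0 s) (vcoef (advection v w) k 0 s).
Proof.
rewrite mxE coef_regular.
have rD r : cregular (fun x => (dfun (v r) x)%:C * (dfun (dpartial r (w s)) x)%:C *
    fourier_basis (- k) x).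
  apply: cregularM; last exact: cregular_fourier_basis.
  apply: cregularM.
    apply: (fourier_series_regular (coef_sum_le r)) => x.
    exact: (has_sum_dfun x (dv r) (coef_sum_le r)).
  apply: (fourier_series_regular (coef_dpartial_sum_le r s)) => x.
  exact: (has_sum_dfun_dpartial x (dw s) (coef_dpartial_sum_le r s)).
have -> : ctorus_integral (fun x =>
      (\sum_(r < d) dfun (v r) x * dfun (dpartial r (w s)) x)%:C * fourier_basis (- k) x) =
    \sum_(r < d) ctorus_integral (fun x =>
      (dfun (v r) x)%:C * (dfun (dpartial r (w s)) x)%:C * fourier_basis (- k) x).
  have := ctorus_integral_sum (index_enum 'I_d) (fun=> 1) rD.
  under [in X in _ = X -> _]eq_bigr do rewrite mul1r.
  move=> <-; congr ctorus_integral; apply/funext => x.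
  rewrite rmorph_sum mulr_suml; apply: eq_bigr => r _.
  by rewrite mul1r rmorphM.
have -> : (fun h => mode_product h (k - h) 0 s) = (fun h => \sum_(r < d)
    kappa%:C * (coef (v r) h * coef (dpartial r (w s)) (k - h))).
  apply/funext => h; rewrite /mode_product !mxE /dot mulr_sumr mulr_suml.
  by apply: eq_bigr => r _; rewrite coef_dpartial// !mxE; ring.
apply: has_sum_big => r.
apply: (fourier_product_coef k (coef_sum_le r) (coef_dpartial_sum_le r s)) => x.
  exact: (has_sum_dfun x (dv r) (coef_sum_le r)).
exact: (has_sum_dfun_dpartial x (dw s) (coef_dpartial_sum_le r s)).
Qed.

Lemma vcoef_advectionN k :
  vcoef (advection v w) (- k) = conjv (vcoef (advection v w) k).
Proof.
apply/rowP => s; rewrite [RHS]mxE.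
have h := has_sum_reindex (@opprK _) (@opprK _) (has_sum_advection (- k) s).
apply: has_sum_unique h _.
have -> : (fun h => mode_product h (- k - h) 0 s) \o -%R =
    (fun h => conjc (mode_product h (k - h) 0 s)).
  apply/funext => h' /=.
  have -> : - k - - h' = - (k - h') by rewrite opprB opprK addrC.
  rewrite /mode_product !vcoefN// cvecN dotNr -conjv_cvec -conj_dot !mxE !conjcM conjc_real.
  have -> : conjc 'i%C = - 'i%C :> R[i].
    by apply/eqP; rewrite eq_complex/= oppr0 !eqxx.
  by rewrite conjv_cvec; ring.
by apply: has_sum_conj; exact: has_sum_advection.
Qed.

End Advection.

End DistributionCoefficients.

(** * Real powers and one-dimensional zeta sums *)

Section RealPowers.
Context {R : realType}.
Implicit Types (x y z t p a : R).

Lemma ln_le_subr1 x : 0 < x -> ln x <= x - 1.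
Proof. by move=> x0; have := @le_ln1Dx _ (x - 1); rewrite subrKC; apply; lra. Qed.

Lemma bernoulli_powR t p : 0 <= t -> 1 <= p -> 1 + p * (t - 1) <= t `^ p.
Proof.
move=> t0 p1; have [s0|s0] := leP (1 + p * (t - 1)) 0.
  by rewrite (le_trans s0)// powR_ge0.
move: t0; rewrite le_eqVlt => /predU1P[<-|t0].
  by rewrite powR0 ?gt_eqF//; lra.
rewrite /powR gt_eqF//; set s := 1 + _ in s0 *.
rewrite -(@lnK _ s) ?posrE// ler_expR.
(* Add the bounds for ln (s / t) and, (p - 1) times, for ln (1 / t): the
   right-hand sides cancel because s + p - 1 = p t. *)
have h1 := ln_le_subr1 (divr_gt0 s0 t0).
have h2 : ln t^-1 <= t^-1 - 1 by apply: ln_le_subr1; rewrite invr_gt0.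
rewrite ln_div ?posrE// in h1; rewrite lnV ?posrE// in h2.
have h3 : (p - 1) * - ln t <= (p - 1) * (t^-1 - 1) by rewrite ler_wpM2l//; lra.
have e : s / t - 1 + (p - 1) * (t^-1 - 1) = 0.
  by rewrite /s; field; rewrite gt_eqF.
lra.
Qed.

Lemma powR_sub_le x y p : 0 <= y -> y <= x -> 1 <= p ->
  x `^ p - y `^ p <= p * (x - y) * x `^ (p - 1).
Proof.
move=> y0 yx p1; have p0 : 0 < p by lra.
have : 0 <= x by exact: le_trans yx.
rewrite le_eqVlt => /predU1P[x0|x0].
  have -> : y = 0 by lra.
  by rewrite -x0 subrr subr0 mulr0 mul0r.
have := bernoulli_powR (divr_ge0 y0 (ltW x0)) p1.
rewrite -(ler_pM2r (powR_gt0 p x0)) 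
  -(powRM p (divr_ge0 y0 (ltW x0)) (ltW x0)) divfK ?gt_eqF//.
rewrite -(mulr_powRB1 (ltW x0) p0).
have -> : (1 + p * (y / x - 1)) * (x * x `^ (p - 1)) =
    x * x `^ (p - 1) - p * (x - y) * x `^ (p - 1) by field; rewrite gt_eqF.
lra.
Qed.

Lemma powR_add_le x y p : 0 <= x -> 0 <= y -> 0 <= p ->
  (x + y) `^ p <= 2 `^ p * (x `^ p + y `^ p).
Proof.
move=> x0 y0 p0.
wlog yx : x y x0 y0 / y <= x => [H|].
  have [/H|/ltW/H] := leP y x; first by apply.
  by rewrite addrC [x `^ p + _]addrC; apply.
apply: (@le_trans _ _ ((2 * x) `^ p)).
  by apply: ge0_ler_powR; rewrite ?nnegrE ?addr_ge0 ?mulr_ge0//; lra.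
by rewrite powRM// ler_wpM2l ?powR_ge0// lerDl powR_ge0.
Qed.

Lemma powR_dist_le x y z p : 0 <= x -> 0 <= y -> 1 <= p -> `|x - y| <= z ->
  `|x `^ p - y `^ p| <= p * z * (y + z) `^ (p - 1).
Proof.
move=> x0 y0 p1 xy.
have z0 : 0 <= z by exact: le_trans xy.
have p0 : 0 <= p - 1 by lra.
have key (a b : R) : 0 <= b -> b <= a -> a <= y + z -> a - b <= z ->
    `|a `^ p - b `^ p| <= p * z * (y + z) `^ (p - 1).
  move=> b0 ba ayz abz; have a0 : 0 <= a by exact: le_trans ba.
  rewrite ger0_norm ?subr_ge0; last by apply: ge0_ler_powR; rewrite ?nnegrE//; lra.
  apply: le_trans (powR_sub_le b0 ba p1) _.
  apply: (@le_trans _ _ (p * z * a `^ (p - 1))).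
    by rewrite ler_wpM2r ?powR_ge0// ler_wpM2l//; lra.
  rewrite ler_wpM2l ?mulr_ge0//; first by lra.
  by apply: ge0_ler_powR; rewrite ?nnegrE//; exact: addr_ge0.
move: xy; rewrite ler_norml => /andP[h1 h2].
have [yx|/ltW xy] := leP y x; first by apply: key => //; lra.
by rewrite distrC; apply: key => //; lra.
Qed.

(** Telescoping: the n-th term of the series is at most a multiple of the
    increment of the decreasing function x^(1-a). *)
Lemma zeta_nat a : 1 < a ->
  sum_le (fun n : nat => (Num.max 1 n%:R) `^ (- a)) (2 + (a - 1)^-1).
Proof.
move=> a1; pose b := a - 1; have b0 : 0 < b by rewrite /b; lra.
have step (m : nat) : (m.+2%:R : R) `^ (- a) <=
    b^-1 * (m.+1%:R `^ (- b) - m.+2%:R `^ (- b)).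
  set x : R := m.+2%:R; set y : R := m.+1%:R.
  have x0 : 0 < x by rewrite ltr0n.
  have y0 : 0 < y by rewrite ltr0n.
  have xy : x = y + 1 by rewrite /x /y natr1.
  rewrite mulrC ler_pdivlMr//.
  have -> : y `^ (- b) = x `^ (- b) * (y / x) `^ (- b).
    by rewrite -powRM ?divr_ge0 ?ltW// mulrCA divff ?mulr1// gt_eqF.
  have -> : x `^ (- a) = x `^ (- b) / x.
    rewrite -(powR_inv1 (ltW x0)) -powRD; last by rewrite (gt_eqF x0) implybT.
    by congr (_ `^ _); rewrite /b; lra.
  have -> : x `^ (- b) / x * b = x `^ (- b) * (b / x) by ring.
  have -> : x `^ (- b) * (y / x) `^ (- b) - x `^ (- b) =
    x `^ (- b) * ((y / x) `^ (- b) - 1) by ring.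
  rewrite ler_wpM2l ?powR_ge0// lerBrDl.
  rewrite /powR gt_eqF ?divr_gt0//; apply: le_trans (expR_ge1Dx _).
  rewrite mulNr -mulrN lerD2l ler_wpM2l ?(ltW b0)//.
  have := ln_le_subr1 (divr_gt0 y0 x0).
  have -> : y / x - 1 = - x^-1.
    by rewrite (_ : y = x - 1) ?xy ?addrK// -xy; field; rewrite gt_eqF.
  by move=> h; rewrite lerNr.
have part (N : nat) : \sum_(n < N.+2) (Num.max 1 (n : nat)%:R : R) `^ (- a) <=
    2 + b^-1 * (1 - N.+1%:R `^ (- b)).
  elim: N => [|N IH].
    rewrite !big_ord_recr/= big_ord0 max_l// max_l// !powR1.
    by rewrite subrr mulr0; lra.
  rewrite big_ord_recr/=; have := step N; rewrite max_r ?ler1n//.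
  move: IH; lra.
move=> F.
have [N hN] : exists N, forall n, n \in F -> (n < N.+2)%N.
  exists (\max_(n <- F) n) => n nF; rewrite ltnS (leq_trans _ (leqnSn _))//.
  by rewrite big_seq; exact: (@leq_bigmax_seq _ _ _ id).
apply: (@le_trans _ _ (\sum_(n < N.+2) (Num.max 1 (n : nat)%:R : R) `^ (- a))).
  rewrite -(big_mkord xpredT (fun n => (Num.max 1 n%:R : R) `^ (- a))).
  rewrite /index_iota subn0.
  have -> : \sum_(i <- iota 0 N.+2) (Num.max 1 i%:R : R) `^ (- a) =
      \sum_(i <- [fset i | i in iota 0 N.+2]%fset) (Num.max 1 i%:R) `^ (- a).
    apply: perm_big; apply: uniq_perm; rewrite ?iota_uniq ?fset_uniq//.
    by move=> i; rewrite !inE.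
  apply: fsum_le_subset => [i|]; first exact: powR_ge0.
  apply/fsubsetP => i /hN iN; have iI : i \in iota 0 N.+2 by rewrite mem_iota.
  by apply/imfsetP; exists i.
apply: le_trans (part N) _; rewrite lerD2l.
by rewrite -[leRHS]mulr1 ler_wpM2l ?invr_ge0 ?(ltW b0)// gerDl oppr_le0 powR_ge0.
Qed.

Lemma zeta_int a : 1 < a ->
  sum_le (fun m : int => (Num.max 1 `|m|%:~R : R) `^ (- a)) ((2 + (a - 1)^-1) *+ 2).
Proof.
move=> a1 F; pose g (n : nat) := (Num.max 1 n%:R : R) `^ (- a).
have E (G : {fset int}) : {in G &, injective absz} ->
    \sum_(m <- G) g `|m|%N <= 2 + (a - 1)^-1.
  move=> inj; apply: le_trans (zeta_nat a1 [fset absz m | m in G]%fset).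
  by rewrite big_imfset.
have -> : \sum_(m <- F) (Num.max 1 `|m|%:~R : R) `^ (- a) = \sum_(m <- F) g `|m|%N.
  by apply: eq_bigr => m _; rewrite /g natr_absz.
rewrite (big_fsetID _ (fun m : int => 0 <= m))/= mulr2n; apply: lerD; apply: E.
  move=> [m|m] [n|n]; rewrite !inE /= => /andP[_] // _ /andP[_] // _.
  by move=> ->.
move=> [m|m] [n|n]; rewrite !inE /= => /andP[_] // _ /andP[_] // _.
by move=> [->].
Qed.

End RealPowers.

(** * Boundedness of the sums defining G_pn *)

Section LatticeSums.
Context {R : realType}.

Lemma sum_le_prod (I J : choiceType) (g : I -> R) (h : J -> R) G H :
  (forall i, 0 <= g i) -> (forall j, 0 <= h j) -> sum_le g G -> sum_le h H ->
  sum_le (fun x : I * J => g x.1 * h x.2) (G * H).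
Proof.
move=> g0 h0 gG hH F.
pose F1 := [fset x.1 | x in F]%fset; pose F2 := [fset x.2 | x in F]%fset.
apply: (@le_trans _ _ (\sum_(x <- (F1 `*` F2)%fset) g x.1 * h x.2)).
  apply: fsum_le_subset => [x|]; first exact: mulr_ge0.
  apply/fsubsetP => x xF; rewrite in_fsetM; apply/andP; split.
    by apply/imfsetP; exists x.
  by apply/imfsetP; exists x.
rewrite fsetM_sum/=; under eq_bigr do rewrite -mulr_sumr.
by rewrite -mulr_suml; apply: ler_pM => //; exact: sumr_ge0.
Qed.

Lemma sum_le_lattice_prod (g : int -> R) G d : (forall m, 0 <= g m) -> sum_le g G ->
  sum_le (fun k : 'rV[int]_d => \prod_(r < d) g (k 0 r)) (G ^+ d).
Proof.
move=> g0 gG; elim: d => [|d IH] F.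
  have F0 : (F `<=` [fset 0])%fset by apply/fsubsetP => k _; rewrite inE [k]thinmx0.
  apply: (le_trans (fsum_le_subset _ F0)) => [k|]; first by rewrite big_ord0.
  by rewrite big_seq_fset1 big_ord0.
pose u (k : 'rV[int]_d.+1) : int * 'rV[int]_d := (k 0 ord0, \row_r k 0 (lift ord0 r)).
have uI : injective u.
  move=> k k' [e0 e1]; apply/rowP => r; have [j ->|->//] := unliftP ord0 r.
  by have := congr1 (fun v : 'rV[int]_d => v 0 j) e1; rewrite !mxE.
have p0 (k : 'rV[int]_d) : 0 <= \prod_(r < d) g (k 0 r) by exact: prodr_ge0.
rewrite exprS; have h := sum_le_inj uI (sum_le_prod g0 p0 gG IH).
apply: le_trans (h F); apply: ler_sum => k _.
by rewrite big_ord_recl/=; under [in leRHS]eq_bigr do rewrite mxE.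
Qed.

Variable d : nat.

Lemma max1_le_knorm (k : 'rV[int]_d) r : k != 0 ->
  Num.max 1 `|k 0 r|%:~R <= knorm k :> R.
Proof.
by move=> k0; rewrite ge_max knorm_ge1//= intr_norm knorm_entry.
Qed.

(** The lattice function |k|^-s, cut off at the origin. *)
Definition lattice_weight (s : R) (k : 'rV[int]_d) : R :=
  if k == 0 then 0 else knorm k `^ (- s).

Lemma lattice_weight_ge0 s k : 0 <= lattice_weight s k.
Proof. by rewrite /lattice_weight; case: ifP => // _; exact: powR_ge0. Qed.

(** |k| dominates every max(1, |k_r|), so |k|^-s is at most the product of the
    one-dimensional summands max(1, |k_r|)^(-s/d), whose exponent is beyond 1. *)
Lemma lattice_zeta (s : R) : (0 < d)%N -> d%:R < s ->
  exists Z, sum_le (lattice_weight s) Z.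
Proof.
move=> d0 ds; have d0' : 0 < d%:R :> R by rewrite ltr0n.
have a1 : 1 < s / d%:R by rewrite ltr_pdivlMr// mul1r.
pose g (m : int) : R := (Num.max 1 `|m|%:~R) `^ (- (s / d%:R)).
have g0 m : 0 <= g m by exact: powR_ge0.
have h := sum_le_lattice_prod (d := d) g0 (zeta_int a1).
exists (((2 + (s / d%:R - 1)^-1) *+ 2) ^+ d); apply: sum_le_mono h => k.
rewrite /lattice_weight; case: eqP => [_|/eqP k0]; first exact: prodr_ge0.
have -> : knorm k `^ (- s) = \prod_(r < d) (knorm k `^ (- (s / d%:R)) : R).
  rewrite prodr_const card_ord -powR_mulrn ?powR_ge0// -powRrM.
  by congr (_ `^ _); rewrite mulNr divfK// gt_eqF.
apply: ler_prod => r _; rewrite powR_ge0/= /g !powRN.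
have m0 : 0 < Num.max 1 `|k 0 r|%:~R :> R by rewrite lt_max ltr01.
rewrite lef_pV2 ?posrE ?powR_gt0 ?knorm_gt0//.
apply: ge0_ler_powR; rewrite ?nnegrE ?knorm_ge0 ?(ltW m0)//; first by lra.
exact: max1_le_knorm.
Qed.

End LatticeSums.

Section ProjectionNorm.
Context {R : realType} {d : nat}.
Implicit Types (h l k : 'rV[int]_d) (a b : 'rV[R[i]]_d).

Let bounds h l := [set Q : R | 0 <= Q /\ forall a b : 'rV[R[i]]_d,
    dot (cvec h) a = 0 -> dot (cvec l) b = 0 ->
    cnorm (Pmap h l a b) <= Q * cnorm a * cnorm b].

(* Cauchy-Schwarz for the scalar factor, and a projection does not increase
   the norm. *)
Let bounds1 h l : bounds h l 1.
Proof.
split => // a b _ _; rewrite mul1r /Pmap cnormZ ComplexField.Normc.normcM.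
rewrite ComplexField.Normc.normcV normcR (ger0_norm (knorm_ge0 l)).
apply: ler_pM; rewrite ?cnorm_ge0 ?cnorm_leray//.
  by rewrite divr_ge0 ?normc_ge0 ?knorm_ge0.
have [l0|l0] := eqVneq (knorm l : R) 0; first by rewrite l0 invr0 mulr0 cnorm_ge0.
rewrite ler_pdivrMr ?lt_neqAle ?knorm_ge0 1?eq_sym ?l0//; exact: normc_dot.
Qed.

Let bounds_lb h l : lbound (bounds h l) 0. Proof. by move=> Q []. Qed.

Lemma Pnorm_ge0 h l : 0 <= Pnorm h l :> R.
Proof. by apply: lb_le_inf; [exists 1; exact: bounds1|exact: bounds_lb]. Qed.

Lemma Pnorm_le1 h l : Pnorm h l <= 1 :> R.
Proof. by apply: ge_inf; [exists 0; exact: bounds_lb|exact: bounds1]. Qed.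

(** The admissible bounds form a closed set, which contains its infimum. *)
Lemma cnorm_Pmap h l a b : dot (cvec h) a = 0 -> dot (cvec l) b = 0 ->
  cnorm (Pmap h l a b) <= Pnorm h l * cnorm a * cnorm b.
Proof.
move=> ha hb; rewrite -mulrA.
have : 0 <= cnorm a * cnorm b by rewrite mulr_ge0 ?cnorm_ge0.
rewrite le_eqVlt => /predU1P[ab0|ab0].
  by have := (bounds1 h l).2 a b ha hb; rewrite mul1r -ab0 mulr0.
rewrite -ler_pdivrMr//; apply: lb_le_inf; first by exists 1; exact: bounds1.
by move=> Q [_ hQ]; rewrite ler_pdivrMr// mulrA; exact: hQ.
Qed.

End ProjectionNorm.

Section SummandBound.
Context {R : realType}.
Implicit Types p n K H L P x y z : R.

Lemma powR_dist_split p K H L : 1 < p -> 0 < H -> 0 < L -> 0 <= K -> `|K - L| <= H ->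
  `|K `^ p - L `^ p| <= p * 2 `^ (p - 1) * (H `^ p + H * L `^ (p - 1)).
Proof.
move=> p1 H0 L0 K0 KL; have p0 : 0 < p by lra.
apply: le_trans (powR_dist_le K0 (ltW L0) (ltW p1) KL) _.
have h1 : (L + H) `^ (p - 1) <= 2 `^ (p - 1) * (L `^ (p - 1) + H `^ (p - 1)).
  by apply: powR_add_le; [exact: ltW|exact: ltW|lra].
have -> : p * 2 `^ (p - 1) * (H `^ p + H * L `^ (p - 1)) =
    p * H * (2 `^ (p - 1) * (L `^ (p - 1) + H `^ (p - 1))).
  by rewrite -(mulr_powRB1 (ltW H0) p0); ring.
by apply: ler_wpM2l h1; exact: mulr_ge0 (ltW p0) (ltW H0).
Qed.

Lemma denominator_split p n H L : 0 < H -> 0 < L ->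
  H `^ p + H * L `^ (p - 1) <=
  (H `^ p * L `^ (n - 1) + H `^ n * L `^ (p - 1)) *
  (L `^ (- (n - 1)) + H `^ (- (n - 1))).
Proof.
move=> H0 L0.
have e1 : L `^ (n - 1) * L `^ (- (n - 1)) = 1.
  by rewrite powRN mulfV// gt_eqF// powR_gt0.
have e2 : H `^ n * H `^ (- (n - 1)) = H.
  rewrite -powRD; last by rewrite (gt_eqF H0) implybT.
  by rewrite opprB addrC subrK powRr1 ?(ltW H0).
move: e1 e2 (powR_ge0 H p) (powR_ge0 H n) (powR_ge0 L (p - 1)) (powR_ge0 L (n - 1))
  (powR_ge0 L (- (n - 1))) (powR_ge0 H (- (n - 1))).
move: (H `^ p) (H `^ n) (L `^ (p - 1)) (L `^ (n - 1)) (L `^ (- (n - 1)))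
  (H `^ (- (n - 1))) => a b c e x y e1 e2 a0 b0 c0 e0 x0 y0.
have -> : (a * e + b * c) * (x + y) = a * (e * x) + (b * y) * c + (a * e * y + b * c * x).
  by ring.
rewrite e1 e2 mulr1 lerDl.
by apply: addr_ge0; apply: mulr_ge0 => //; exact: mulr_ge0.
Qed.

(** The difference of powers is at most C (H^p + H L^(p-1)), and the two terms
    in the parenthesis are at most the denominator times L^(1-n), resp.
    H^(1-n). *)
Lemma summand_bound p n K H L P : 1 < n -> n <= p -> 0 < H -> 0 < L -> 0 <= K ->
  `|K - L| <= H -> 0 <= P -> P <= 1 ->
  (K `^ p - L `^ p) ^+ 2 * P ^+ 2 /
    (H `^ p * L `^ (n - 1) + H `^ n * L `^ (p - 1)) ^+ 2 <=
  2 * (p * 2 `^ (p - 1)) ^+ 2 * (L `^ (- (2 * (n - 1))) + H `^ (- (2 * (n - 1)))).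
Proof.
move=> n1 np H0 L0 K0 KL P0 P1; have p1 : 1 < p by lra.
have E1 := powR_dist_split p1 H0 L0 K0 KL.
have E2 := denominator_split p n H0 L0.
have sq z : z `^ (- (2 * (n - 1))) = (z `^ (- (n - 1))) ^+ 2.
  by rewrite -powR_mulrn ?powR_ge0// -powRrM; congr (_ `^ _); ring.
have C0 : 0 <= p * 2 `^ (p - 1) by rewrite mulr_ge0 ?powR_ge0//; lra.
have D0 : 0 < H `^ p * L `^ (n - 1) + H `^ n * L `^ (p - 1).
  by rewrite addr_gt0// mulr_gt0// powR_gt0.
rewrite !sq; move: E1 E2 C0 D0 (powR_ge0 L (- (n - 1))) (powR_ge0 H (- (n - 1))).
move: (H `^ p * L `^ (n - 1) + H `^ n * L `^ (p - 1)) (p * 2 `^ (p - 1))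
  (H `^ p + H * L `^ (p - 1)) (L `^ (- (n - 1))) (H `^ (- (n - 1))) (K `^ p - L `^ p)
  => D C S x y N E1 E2 C0 D0 x0 y0.
have E : `|N| * P <= D * (C * (x + y)).
  apply: (@le_trans _ _ `|N|); first by rewrite ler_piMr.
  by apply: (le_trans E1); rewrite [leRHS]mulrCA ler_wpM2l.
have -> : N ^+ 2 * P ^+ 2 = (`|N| * P) ^+ 2 by rewrite exprMn real_normK ?num_real.
rewrite ler_pdivrMr ?exprn_gt0//.
apply: (@le_trans _ _ ((D * (C * (x + y))) ^+ 2)).
  by rewrite ler_pXn2r// nnegrE ?mulr_ge0//; rewrite ?addr_ge0// ltW.
rewrite -subr_ge0.
have -> : 2 * C ^+ 2 * (x ^+ 2 + y ^+ 2) * D ^+ 2 - (D * (C * (x + y))) ^+ 2 =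
  (D * C * (x - y)) ^+ 2 by ring.
exact: sqr_ge0.
Qed.

End SummandBound.

Section BoundedSup.
Context {R : realType} {d : nat}.
Variables (p n : R).
Implicit Types (h l k : 'rV[int]_d).
Local Notation knorm := (@knorm R d).

Definition Gdenominator h l : R :=
  knorm h `^ p * knorm l `^ (n - 1) + knorm h `^ n * knorm l `^ (p - 1).

Definition Gterm k h : R :=
  (knorm k `^ p - knorm (k - h) `^ p) ^+ 2 * Pnorm h (k - h) ^+ 2 /
     Gdenominator h (k - h) ^+ 2.

Lemma Gterm_ge0 k h : 0 <= Gterm k h.
Proof. by rewrite divr_ge0 ?sqr_ge0// mulr_ge0 ?sqr_ge0. Qed.

(** When h = 0 or h = k, both products in the denominator contain a positive
    power of 0, and the inverse of 0 is 0. *)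
Lemma Gterm_out k h (n1 : 1 < n) (hpn : n <= p) : ~ Z0k k h -> Gterm k h = 0.
Proof.
move=> hk; have p1 : 1 < p by exact: lt_le_trans hpn.
have z (x : R) : 0 < x -> knorm 0 `^ x = 0.
  by move=> x0; rewrite knorm0 powR0// gt_eqF.
have [n0 p0 n1' p1'] : [/\ 0 < n, 0 < p, 0 < n - 1 & 0 < p - 1] by split; lra.
rewrite /Gterm; suff -> : Gdenominator h (k - h) = 0.
  by rewrite expr0n/= invr0 !mulr0.
have [h0|h0] := eqVneq h 0; first by rewrite /Gdenominator h0 !z ?mul0r ?mul0r ?addr0.
have [->|hk'] := eqVneq h k.
  by rewrite /Gdenominator subrr !z ?mulr0 ?mulr0 ?addr0.
by case: hk; split; exact/eqP.
Qed.

Lemma Gterm_le k h (n1 : 1 < n) (hpn : n <= p) : Gterm k h <=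
  2 * (p * 2 `^ (p - 1)) ^+ 2 *
  (lattice_weight (2 * (n - 1)) (k - h) + lattice_weight (2 * (n - 1)) h).
Proof.
have [hh|/Gterm_out -> //] := pselect (Z0k k h); last first.
  by rewrite mulr_ge0 ?addr_ge0 ?lattice_weight_ge0// mulr_ge0 ?sqr_ge0.
have /eqP h0 : h <> 0 := hh.1.
have l0 : k - h != 0 by rewrite subr_eq0 eq_sym; apply/eqP; exact: hh.2.
rewrite /lattice_weight (negbTE h0) (negbTE l0).
apply: summand_bound => //; rewrite ?knorm_gt0 ?knorm_ge0 ?Pnorm_ge0 ?Pnorm_le1//.
have h1 := knormD (R := R) h (k - h); rewrite addrC subrK in h1.
have h2 := knormD (R := R) k (- h); rewrite knormN in h2.
by rewrite ler_norml lerNl opprB lerBlDl lerBlDr h1 h2.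
Qed.

(** The bound of the summand is a sum of two lattice functions of exponent
    2 (n - 1) > d, one of them translated, so its sum does not depend on k. *)
Lemma Gterm_sum_le (n1 : 1 < n) (hpn : n <= p) (d0 : (0 < d)%N)
    (hn : d%:R / 2 + 1 < n) : exists2 K, 0 <= K & forall k, sum_le (Gterm k) K.
Proof.
have [Z hZ] : exists Z, sum_le (@lattice_weight R d (2 * (n - 1))) Z.
  apply: lattice_zeta => //; lra.
have C0 : 0 <= 2 * (p * 2 `^ (p - 1)) ^+ 2 by rewrite mulr_ge0 ?sqr_ge0.
exists (2 * (p * 2 `^ (p - 1)) ^+ 2 * (Z + Z)).
  by rewrite mulr_ge0// addr_ge0// (sum_le_ge0 hZ).
move=> k; have inj : injective (fun h : 'rV[int]_d => k - h).
  by move=> a b /addrI/oppr_inj.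
have hZk := sum_le_inj inj hZ.
exact: sum_le_mono (fun h => Gterm_le k h n1 hpn) (sum_leZ C0 (sum_leD hZk hZ)).
Qed.

Lemma GcalE k : Gcal p n k = (4%:E * \esum_(h in Z0k k) (Gterm k h)%:E)%E.
Proof. by []. Qed.

Lemma Gcal_ge0 k : (0 <= Gcal p n k)%E.
Proof.
rewrite GcalE mule_ge0 ?lee_fin//; apply: esum_ge0 => h _.
by rewrite lee_fin Gterm_ge0.
Qed.

Lemma supG_lty (n1 : 1 < n) (hpn : n <= p) (d0 : (0 < d)%N)
    (hn : d%:R / 2 + 1 < n) : (supG d p n < +oo)%E.
Proof.
have [K K0 hK] := Gterm_sum_le n1 hpn d0 hn.
apply: (@le_lt_trans _ _ (4 * K)%:E); last exact: ltry.
apply: ge_ereal_sup => _ [k _ <-]; rewrite GcalE EFinM lee_pmul2l//.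
exact: sum_le_esum.
Qed.

Lemma supG_ge k : k != 0 -> (Gcal p n k <= supG d p n)%E.
Proof. by move=> k0; apply: ereal_sup_ubound; exists k => //; exact/eqP. Qed.

Lemma Gterm_sum_supG k : 1 < n -> n <= p -> (supG d p n < +oo)%E -> k != 0 ->
  sum_le (Gterm k) (fine (supG d p n) / 4).
Proof.
move=> n1 hpn supy k0; apply: (@esum_sum_le _ _ (Z0k k)).
- exact: Gterm_ge0.
- by move=> h; exact: Gterm_out.
- have fin : supG d p n \is a fin_num.
    by rewrite ge0_fin_numE// (le_trans (Gcal_ge0 k))// supG_ge.
  rewrite -(@lee_pmul2l _ 4%:E)// -EFinM mulrCA divff// mulr1.
  by rewrite fineK//; exact: supG_ge.
Qed.

End BoundedSup.

(** * Young's inequality and Sobolev weights *)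

Section YoungInequality.
Context {R : realType} {I : choiceType}.

Lemma has_sum_real_le (g : I -> R) (s : R[i]) : (forall i, 0 <= g i) ->
  has_sum (fun i => (g i)%:C) s -> sum_le g (Re s).
Proof.
move=> g0 hs F; apply/ler_addgt0Pr => e /hs[F0 h0].
have := le_trans (normr_Re _) (h0 _ (fsubsetUr F F0)).
rewrite ReD ReN Re_sum ler_norml => /andP[_].
rewrite lerBlDl => h; apply: le_trans h.
by apply: fsum_le_subset; rewrite ?fsubsetUl.
Qed.

Lemma minkowski_seq (J : Type) (s : seq J) (x y : J -> R) (X Y : R) :
  0 <= X -> 0 <= Y -> \sum_(i <- s) x i ^+ 2 <= X ^+ 2 ->
  \sum_(i <- s) y i ^+ 2 <= Y ^+ 2 ->
  \sum_(i <- s) (x i + y i) ^+ 2 <= (X + Y) ^+ 2.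
Proof.
move=> X0 Y0 hX hY; have hXY := cauchy_schwarz_sqrt X0 Y0 hX hY.
have -> : \sum_(i <- s) (x i + y i) ^+ 2 = \sum_(i <- s) x i ^+ 2 +
    2 * (\sum_(i <- s) x i * y i) + \sum_(i <- s) y i ^+ 2.
  by rewrite mulr_sumr -!big_split/=; apply: eq_bigr => i _; ring.
move: hX hY hXY; move: (\sum_(i <- s) x i ^+ 2) (\sum_(i <- s) y i ^+ 2)
  (\sum_(i <- s) x i * y i) => A B S hA hB hS.
have -> : (X + Y) ^+ 2 = X ^+ 2 + 2 * (X * Y) + Y ^+ 2 by ring.
by rewrite lerD// lerD// ler_wpM2l.
Qed.

(** Young's inequality for l^1 * l^2 -> l^2: Cauchy-Schwarz with x split as
    (sqrt x)(sqrt x). The index maps [u] and [v] cover both positions of the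
    l^1 factor in a convolution. *)
Lemma young_seq (x y : I -> R) (X Y : R) (u v : I -> I -> I) :
  (forall i, 0 <= x i) -> 0 <= Y -> sum_le x X -> sum_le (fun i => y i ^+ 2) (Y ^+ 2) ->
  (forall k, injective (u k)) ->
  injective (fun kl : I * I => (u kl.1 kl.2, v kl.1 kl.2)) ->
  forall K L : {fset I},
  \sum_(k <- K) (\sum_(l <- L) x (u k l) * y (v k l)) ^+ 2 <= (X * Y) ^+ 2.
Proof.
move=> x0 Y0 hX hY uI uvI K L.
have X0 := sum_le_ge0 hX.
apply: (@le_trans _ _ (\sum_(k <- K) X * \sum_(l <- L) x (u k l) * y (v k l) ^+ 2)).
  apply: ler_sum => k _.
  have -> : \sum_(l <- L) x (u k l) * y (v k l) =
      \sum_(l <- L) Num.sqrt (x (u k l)) * (Num.sqrt (x (u k l)) * y (v k l)).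
    by apply: eq_bigr => l _; rewrite mulrA -expr2 sqr_sqrtr.
  apply: (le_trans (cauchy_schwarz_seq _ _ _)).
  have -> : \sum_(l <- L) (Num.sqrt (x (u k l)) * y (v k l)) ^+ 2 =
      \sum_(l <- L) x (u k l) * y (v k l) ^+ 2.
    by apply: eq_bigr => l _; rewrite exprMn sqr_sqrtr.
  under eq_bigr do rewrite sqr_sqrtr//.
  apply: ler_wpM2r; last exact: (sum_le_inj (uI k) hX).
  by apply: sumr_ge0 => l _; rewrite mulr_ge0 ?sqr_ge0.
rewrite -mulr_sumr exprMn expr2 -mulrA; apply: ler_wpM2l => //.
have := sum_le_inj uvI (sum_le_prod x0 (fun i => sqr_ge0 (y i)) hX hY).
by move/(_ (K `*` L)%fset); rewrite fsetM_sum.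
Qed.

End YoungInequality.

Section SobolevSpaces.
Context {R : realType} {d : nat}.
Local Notation knorm := (@knorm R d).
Local Notation kappa := (@basis_scale R d).
Implicit Types (v w : vfunctional R d) (k h l : 'rV[int]_d) (m p : R).

(** The square summable weighted moduli behind the norm of order [m]. *)
Definition sobolev_weight m v k : R := knorm k `^ m * cnorm (vcoef v k).

Lemma sobolev_weight_ge0 m v k : 0 <= sobolev_weight m v k.
Proof. by rewrite mulr_ge0 ?powR_ge0 ?cnorm_ge0. Qed.

Lemma sobolev_weight_sqr m v k :
  knorm k `^ (2 * m) * cnorm (vcoef v k) ^+ 2 = sobolev_weight m v k ^+ 2.
Proof.
by rewrite /sobolev_weight exprMn -(powR_mulrn 2 (powR_ge0 _ _)) -powRrM [2 * m]mulrC.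
Qed.

Lemma sobolev_weight_mono m p v k : vcoef v 0 = 0 -> m <= p ->
  sobolev_weight m v k ^+ 2 <= sobolev_weight p v k ^+ 2.
Proof.
move=> v0 mp; have [->|k0] := eqVneq k 0.
  by rewrite /sobolev_weight v0 cnorm0 !mulr0.
rewrite ler_pXn2r ?nnegrE ?sobolev_weight_ge0//.
by rewrite ler_wpM2r ?cnorm_ge0// ler_powR// knorm_ge1.
Qed.

Lemma Hspace_fin p v : Hspace p v ->
  exists T, sum_le (fun k => sobolev_weight p v k ^+ 2) T.
Proof.
move=> [_ _ v0 fin].
exists (fine (\esum_(k in Z0) (knorm k `^ (2 * p) * cnorm (vcoef v k) ^+ 2)%:E)).
apply: (@esum_sum_le _ _ Z0) => [k|k k0|].
- exact: sqr_ge0.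
- have -> : k = 0 by apply: contrapT.
  by rewrite /sobolev_weight v0 cnorm0 mulr0 expr0n.
- under eq_esum do rewrite -sobolev_weight_sqr.
  rewrite fineK// ge0_fin_numE//; apply: esum_ge0 => k _.
  by rewrite lee_fin mulr_ge0 ?powR_ge0 ?sqr_ge0.
Qed.

Lemma Hnorm_ge0 m v : 0 <= Hnorm m v.
Proof. exact: sqrtr_ge0. Qed.

Lemma Hspace_sum_le p m v : Hspace p v -> m <= p ->
  sum_le (fun k => sobolev_weight m v k ^+ 2) (Hnorm m v ^+ 2).
Proof.
move=> hv mp; have [_ _ v0 _] := hv; have [T hT] := Hspace_fin hv.
have hm : sum_le (fun k => sobolev_weight m v k ^+ 2) T.
  by apply: sum_le_mono hT => k; exact: sobolev_weight_mono.
have E k : (knorm k `^ (2 * m))%:C * dot (conjv (vcoef v k)) (vcoef v k) =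
    (sobolev_weight m v k ^+ 2)%:C.
  by rewrite dot_conjvv_cnorm -rmorphM/= sobolev_weight_sqr.
have hs : has_sum (fun k => (sobolev_weight m v k ^+ 2)%:C) (inner m v v).
  rewrite /inner; under [fun k : 'rV_d => _ * _]eq_fun do rewrite E.
  apply: (@has_sum_csum _ _ _ _ T) => [k k0|].
    have -> : k = 0 by apply: contrapT.
    by rewrite /sobolev_weight v0 cnorm0 mulr0 expr0n.
  by apply: sum_le_mono hm => k; rewrite normcR ger0_norm// sqr_ge0.
have h := has_sum_real_le (fun k => sqr_ge0 (sobolev_weight m v k)) hs.
by rewrite sqr_sqrtr//; exact: sum_le_ge0 h.
Qed.

(** Cauchy-Schwarz against |k|^-m, which is square summable for 2 m > d. *)
Lemma sobolev_l1 m (x : 'rV[int]_d -> R) (T : R) : (0 < d)%N -> d%:R < 2 * m ->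
  (forall k, 0 <= x k) -> x 0 = 0 ->
  sum_le (fun k => (knorm k `^ m * x k) ^+ 2) T -> exists M, sum_le x M.
Proof.
move=> d0 dm x0 x00 hT; have [Z hZ] := @lattice_zeta R d _ d0 dm.
exists (Num.sqrt Z * Num.sqrt T) => F.
have T0 := sum_le_ge0 hT; have Z0 := sum_le_ge0 hZ.
have -> : \sum_(k <- F) x k =
    \sum_(k <- F) Num.sqrt (lattice_weight (2 * m) k) * (knorm k `^ m * x k).
  apply: eq_bigr => k _; rewrite /lattice_weight.
  case: eqP => [->|/eqP k0]; first by rewrite x00 !mulr0.
  have -> : knorm k `^ (- (2 * m)) = (knorm k `^ (- m)) ^+ 2.
    by rewrite -powR_mulrn ?powR_ge0// -powRrM; congr (_ `^ _); ring.
  rewrite sqrtr_sqr ger0_norm ?powR_ge0// mulrA powRN mulVf ?mul1r//.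
  by rewrite gt_eqF// powR_gt0// knorm_gt0.
apply: cauchy_schwarz_sqrt; [exact: sqrtr_ge0|exact: sqrtr_ge0| |].
  under eq_bigr do rewrite sqr_sqrtr ?lattice_weight_ge0//.
  by rewrite sqr_sqrtr//; exact: hZ.
by rewrite sqr_sqrtr//; exact: hT.
Qed.

Section Product.
Variables (p : R) (v w : vfunctional R d).
Hypotheses (d0 : (0 < d)%N) (p0 : 0 <= p) (dp : d%:R < 2 * p).
Hypotheses (hv : Hspace p v) (hw : Hspace (p + 1) w).

Lemma velocity_l1 : exists M, sum_le (fun k => cnorm (vcoef v k)) M.
Proof.
have [_ _ v0 _] := hv; have [T hT] := Hspace_fin hv.
apply: (sobolev_l1 d0 dp) hT => [k|]; first exact: cnorm_ge0.
by rewrite v0 cnorm0.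
Qed.

Lemma knorm_powR_succ l : knorm l * knorm l `^ p = knorm l `^ (p + 1).
Proof.
by rewrite -(@mulr_powRB1 _ _ (p + 1)) ?knorm_ge0 ?addrK// ltr_wpDl.
Qed.

Lemma gradient_l1 : exists M, sum_le (fun k => knorm k * cnorm (vcoef w k)) M.
Proof.
have [_ _ w0 _] := hw; have [T hT] := Hspace_fin hw.
apply: (sobolev_l1 d0 dp (T := T)) => [k||].
- by rewrite mulr_ge0 ?knorm_ge0 ?cnorm_ge0.
- by rewrite knorm0 mul0r.
- apply: sum_le_mono hT => k; rewrite /sobolev_weight -knorm_powR_succ.
  by rewrite mulrA [knorm k * _]mulrC.
Qed.

(** The size of the contribution of the mode [l] of [w] to the mode [k] of the
    product, weighted for the norm of order [p]. *)
Definition interaction k l : R :=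
  kappa * knorm k `^ p * (cnorm (vcoef v (k - l)) * (knorm l * cnorm (vcoef w l))).

Lemma interaction_ge0 k l : 0 <= interaction k l.
Proof.
rewrite mulr_ge0// ?mulr_ge0 ?powR_ge0 ?cnorm_ge0 ?knorm_ge0//.
by rewrite ltW// basis_scale_gt0.
Qed.

Lemma interaction_le k l : interaction k l <= kappa * 2 `^ p *
  ((knorm l * cnorm (vcoef w l)) * sobolev_weight p v (k - l) +
   cnorm (vcoef v (k - l)) * sobolev_weight (p + 1) w l).
Proof.
have kk : knorm k `^ p <= 2 `^ p * (knorm (k - l) `^ p + knorm l `^ p).
  apply: le_trans (powR_add_le (knorm_ge0 _) (knorm_ge0 _) p0).
  apply: ge0_ler_powR => //; rewrite ?nnegrE ?addr_ge0 ?knorm_ge0//.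
  by have := knormD (R := R) (k - l) l; rewrite subrK.
rewrite /interaction /sobolev_weight -knorm_powR_succ.
move: kk (ltW (basis_scale_gt0 (R := R) (d := d))).
move: (cnorm_ge0 (vcoef v (k - l))) (cnorm_ge0 (vcoef w l)) (knorm_ge0 (R := R) l).
move: (knorm l) kappa (cnorm (vcoef v (k - l))) (cnorm (vcoef w l))
  (knorm k `^ p) (2 `^ p) (knorm (k - l) `^ p) (knorm l `^ p)
  => L c a b A t B C a0 b0 L0 At c0.
have -> : c * t * (L * b * (B * a) + a * (L * C * b)) = c * (t * (B + C)) * (a * (L * b)).
  by ring.
by apply: ler_wpM2r; [rewrite !mulr_ge0|apply: ler_wpM2l].
Qed.

(** Since |k|^p is at most 2^p (|k - l|^p + |l|^p), the weight can be moved to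
    one of the factors, while the other one is in l^1. *)
Lemma interaction_young : exists2 B : R, 0 <= B & forall K L : {fset 'rV[int]_d},
  \sum_(k <- K) (\sum_(l <- L) interaction k l) ^+ 2 <= B ^+ 2.
Proof.
have [Mv hMv] := velocity_l1; have [Mw hMw] := gradient_l1.
have hV := Hspace_sum_le hv (lexx p); have hW := Hspace_sum_le hw (lexx (p + 1)).
have C0 : 0 <= kappa * 2 `^ p by rewrite mulr_ge0 ?powR_ge0// ltW// basis_scale_gt0.
exists (kappa * 2 `^ p * (Mw * Hnorm p v + Mv * Hnorm (p + 1) w)).
  by rewrite mulr_ge0// addr_ge0// mulr_ge0 ?Hnorm_ge0 ?(sum_le_ge0 hMv) ?(sum_le_ge0 hMw).
move=> K L.
have w0 l : 0 <= knorm l * cnorm (vcoef w l) by rewrite mulr_ge0 ?knorm_ge0 ?cnorm_ge0.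
have h1 := young_seq (u := fun _ l => l) (v := fun k l => k - l) w0 (Hnorm_ge0 p v) hMw hV.
have h2 := young_seq (u := fun k l => k - l) (v := fun _ l => l)
  (fun l => cnorm_ge0 (vcoef v l)) (Hnorm_ge0 (p + 1) w) hMv hW.
have inj1 : injective (fun kl : 'rV[int]_d * 'rV[int]_d => (kl.2, kl.1 - kl.2)).
  by move=> [k l] [k' l'] /= [-> e]; rewrite -(subrK l' k) e subrK.
have inj2 : injective (fun kl : 'rV[int]_d * 'rV[int]_d => (kl.1 - kl.2, kl.2)).
  by move=> [k l] [k' l'] /= [e el]; rewrite -(subrK l k) e el subrK.
have inj3 k : injective (fun l : 'rV[int]_d => k - l) by move=> a b /addrI/oppr_inj.
have hM := minkowski_seq (mulr_ge0 (sum_le_ge0 hMw) (Hnorm_ge0 p v))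
  (mulr_ge0 (sum_le_ge0 hMv) (Hnorm_ge0 (p + 1) w)) 
  (h1 (fun _ _ _ => id) inj1 K L) (h2 inj3 inj2 K L).
rewrite exprMn; apply: le_trans (ler_wpM2l (sqr_ge0 _) hM).
rewrite mulr_sumr; apply: ler_sum => k _.
rewrite -exprMn ler_pXn2r// ?nnegrE.
- rewrite -big_split/= mulr_sumr; apply: ler_sum => l _; exact: interaction_le.
- by apply: sumr_ge0 => l _; exact: interaction_ge0.
- rewrite mulr_ge0// addr_ge0//; apply: sumr_ge0 => l _.
    exact: mulr_ge0 (w0 l) (sobolev_weight_ge0 _ _ _).
  by rewrite mulr_ge0 ?cnorm_ge0 ?sobolev_weight_ge0.
Qed.

End Product.

End SobolevSpaces.

(** * The Navier-Stokes product in H^p *)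

Section NavierStokesProduct.
Context {R : realType} {d : nat}.
Local Notation knorm := (@knorm R d).
Local Notation kappa := (@basis_scale R d).
Implicit Types (k h l : 'rV[int]_d).
Variables (p : R) (v w : vfunctional R d).
Hypotheses (d0 : (0 < d)%N) (p0 : 0 <= p) (dp : d%:R < 2 * p).
Hypotheses (hv : Hspace p v) (hw : Hspace (p + 1) w).
Local Notation mode := (mode_product v w).
Local Notation inter := (interaction p v w).
Local Notation u := (vcoef (advection v w)).

Let dv : is_vdistribution v. Proof. by case: hv. Qed.
Let dw : is_vdistribution w. Proof. by case: hw. Qed.
Let divv k : dot (cvec k) (vcoef v k) = 0. Proof. by case: hv. Qed.
Let divw k : dot (cvec k) (vcoef w k) = 0. Proof. by case: hw. Qed.
Let mean_w : vcoef w 0 = 0. Proof. by case: hw. Qed.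

Lemma has_sum_modes k s :
  has_sum (fun l => mode (k - l) l 0 s) (u k 0 s).
Proof.
have [Mv hMv] := velocity_l1 d0 dp hv; have [Mw hMw] := gradient_l1 d0 p0 dp hw.
have h := has_sum_advection dv dw hMv hMw k s.
have kK : cancel (fun l => k - l) (fun l => k - l) by move=> l; rewrite subKr.
have := has_sum_reindex kK kK h; congr (has_sum _ _).
by apply/funext => l /=; rewrite subKr.
Qed.

Lemma normc_i : normc 'i%C = 1 :> R.
Proof. by rewrite /= expr0n/= add0r expr1n sqrtr1. Qed.

Lemma normc_basis_scale : normc kappa%:C = kappa.
Proof. by rewrite normcR ger0_norm// ltW// basis_scale_gt0. Qed.

Lemma cnorm_mode k l : knorm k `^ p * cnorm (mode (k - l) l) <= inter k l.
Proof.
rewrite /mode_product /interaction cnormZ !ComplexField.Normc.normcM normc_i.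
rewrite normc_basis_scale.
move: (normc_dot (vcoef v (k - l)) (cvec l)) (powR_ge0 (knorm k) p)
  (cnorm_ge0 (vcoef w l)) (ltW (basis_scale_gt0 (R := R) (d := d))).
rewrite -/(knorm l).
move: (normc (dot _ _)) (cnorm (vcoef v _)) (cnorm (vcoef w l)) (knorm l)
  (knorm k `^ p) kappa => D V W L A c DVL A0 W0 c0.
have -> : A * (c * 1 * D * W) = A * W * c * D by ring.
have -> : c * A * (V * (L * W)) = A * W * c * (V * L) by ring.
by apply: ler_wpM2l DVL; rewrite !mulr_ge0.
Qed.

(** Incompressibility: for k = 0 the mode -l of [v] meets the gradient of the
    mode l of [w], and v_(-l) is orthogonal to l. *)
Lemma advection_coef0 : u 0 = 0.
Proof.
apply/rowP => s; rewrite [RHS]mxE; apply: has_sum_unique (has_sum_modes 0 s) _.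
have -> : (fun l => mode (0 - l) l 0 s) = (fun=> 0).
  apply/funext => l; rewrite /mode_product mxE sub0r.
  have := divv (- l); rewrite cvecN dotNl dotC => /eqP; rewrite oppr_eq0 => /eqP ->.
  by rewrite mulr0 mul0r.
exact: has_sum0.
Qed.

Lemma inter_row_le B k : 0 <= B ->
  (forall K L : {fset 'rV[int]_d},
     \sum_(k <- K) (\sum_(l <- L) inter k l) ^+ 2 <= B ^+ 2) ->
  sum_le (inter k) B.
Proof.
move=> B0 h L; have := h [fset k]%fset L; rewrite big_seq_fset1.
by rewrite ler_pXn2r ?nnegrE// sumr_ge0// => l _; exact: interaction_ge0.
Qed.

(** Passing to the limit in the inner sum of Young's inequality. The sums are
    paired with the limit itself, which makes the estimate linear in them. *)
Lemma weighted_advection_l2 : exists2 B : R, 0 <= B &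
  sum_le (fun k => (knorm k `^ p * cnorm (u k)) ^+ 2) (B ^+ 2).
Proof.
have [B B0 hB] := interaction_young d0 p0 dp hv hw.
pose b k : R := fine (\esum_(l in setT) (inter k l)%:E).
have hb k : has_sum (fun l => (inter k l)%:C) (b k)%:C.
  apply: (@has_sum_esum _ _ setT (inter k) B) => [l|l []//|]; last exact: inter_row_le.
  exact: interaction_ge0.
have ib k : sum_le (inter k) (b k).
  exact: (has_sum_real_le (fun l => interaction_ge0 p v w k l) (hb k)).
have b0 k : 0 <= b k by exact: sum_le_ge0 (ib k).
have coef_b k : knorm k `^ p * cnorm (u k) <= d%:R * b k.
  apply: le_trans (ler_wpM2l (powR_ge0 _ _) (cnorm_le_sum _)) _.
  rewrite mulr_sumr; apply: (@le_trans _ _ (\sum_(s < d) b k)); last first.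
    by rewrite sumr_const card_ord mulr_natl.
  apply: ler_sum => s _.
  have -> : knorm k `^ p * normc (u k 0 s) = normc ((knorm k `^ p)%:C * u k 0 s).
    by rewrite ComplexField.Normc.normcM normcR ger0_norm ?powR_ge0.
  apply: has_sum_normc_sum_le (has_sumZ _ (has_sum_modes k s)) _.
  apply: sum_le_mono (ib k) => l; apply: le_trans (cnorm_mode k l).
  rewrite ComplexField.Normc.normcM normcR ger0_norm ?powR_ge0//.
  by rewrite ler_wpM2l ?powR_ge0//; exact: normc_entry.
exists (d%:R * B); first by rewrite mulr_ge0.
move=> K.
apply: (@le_trans _ _ (d%:R ^+ 2 * \sum_(k <- K) b k ^+ 2)).
  rewrite mulr_sumr; apply: ler_sum => k _; rewrite -exprMn.
  by rewrite ler_pXn2r// nnegrE ?mulr_ge0 ?powR_ge0 ?cnorm_ge0.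
rewrite exprMn; apply: ler_wpM2l; first exact: sqr_ge0.
set S := \sum_(k <- K) _.
have S0 : 0 <= S by apply: sumr_ge0 => k _; exact: sqr_ge0.
have hS : has_sum (fun l => \sum_(k <- K) (b k)%:C * (inter k l)%:C)
    (\sum_(k <- K) (b k)%:C * (b k)%:C).
  by apply: has_sum_big => k; exact: has_sumZ.
have SB : S <= Num.sqrt S * B.
  rewrite [leLHS](_ : S = normc (\sum_(k <- K) (b k)%:C * (b k)%:C)); last first.
    have -> : \sum_(k <- K) (b k)%:C * (b k)%:C = S%:C.
      by rewrite rmorph_sum; apply: eq_bigr => k _; rewrite -rmorphM expr2.
    by rewrite normcR ger0_norm.
  apply: has_sum_normc_le hS _ => F; exists F; first exact: fsubset_refl.
  rewrite exchange_big/=.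
  have -> : \sum_(k <- K) \sum_(l <- F) (b k)%:C * (inter k l)%:C =
      (\sum_(k <- K) b k * \sum_(l <- F) inter k l)%:C.
    rewrite rmorph_sum; apply: eq_bigr => k _.
    by rewrite rmorphM rmorph_sum mulr_sumr.
  rewrite normcR ger0_norm; last first.
    apply: sumr_ge0 => k _; apply: mulr_ge0 => //; apply: sumr_ge0 => l _.
    exact: interaction_ge0.
  apply: cauchy_schwarz_sqrt; [exact: sqrtr_ge0|exact: B0| |exact: hB].
  by rewrite (sqr_sqrtr S0) -/S.
have [S1|S1] := eqVneq (Num.sqrt S) 0.
  by rewrite -(sqr_sqrtr S0) S1 expr0n/= sqr_ge0.
have {}S1 : 0 < Num.sqrt S by rewrite lt_neqAle eq_sym S1 sqrtr_ge0.
rewrite -(sqr_sqrtr S0) ler_pXn2r ?nnegrE ?sqrtr_ge0//.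
by rewrite -(ler_pM2l S1) -expr2 sqr_sqrtr.
Qed.

Lemma advection_l1 : exists M, sum_le (fun k => cnorm (u k)) M.
Proof.
have [B _ hB] := weighted_advection_l2.
apply: (sobolev_l1 d0 dp) hB => [k|]; first exact: cnorm_ge0.
by rewrite advection_coef0 cnorm0.
Qed.

Lemma NSmap_spec : is_vdistribution (NSmap v w) /\
  forall k, vcoef (NSmap v w) k = leray_symbol k (u k).
Proof.
have [M hM] := advection_l1.
have [Mv hMv] := velocity_l1 d0 dp hv; have [Mw hMw] := gradient_l1 d0 p0 dp hw.
apply: leray_spec hM => k; exact: (vcoef_advectionN dv dw hMv hMw).
Qed.

Lemma NSmap_Hspace : Hspace p (NSmap v w).
Proof.
have [dNS cNS] := NSmap_spec; split => //.
- by move=> k; rewrite cNS dot_cvec_leray.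
- by rewrite cNS advection_coef0 /leray_symbol eqxx.
- have [B _ hB] := weighted_advection_l2.
  apply: le_lt_trans (ltry (B ^+ 2)); apply: sum_le_esum.
  apply: sum_le_mono hB => k; rewrite sobolev_weight_sqr /sobolev_weight cNS.
  rewrite ler_pXn2r// ?nnegrE ?mulr_ge0 ?powR_ge0 ?cnorm_ge0//.
  by rewrite ler_wpM2l ?powR_ge0// cnorm_leray.
Qed.

(** The part of <P(v, w) | w>_p that comes from the mode l of the left [w] and
    the mode k of the right one. The projection is absent because w_k is
    orthogonal to k. *)
Definition inner_summand k l : R[i] :=
  (knorm k `^ (2 * p))%:C * dot (conjv (mode (k - l) l)) (vcoef w k).

Lemma powR_double k : knorm k `^ (2 * p) = knorm k `^ p * knorm k `^ p.
Proof. by rewrite mulrC powRrM powR_mulrn ?powR_ge0// expr2. Qed.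

Lemma normc_inner_summand k l :
  normc (inner_summand k l) <= sobolev_weight p w k * inter k l.
Proof.
rewrite ComplexField.Normc.normcM normcR ger0_norm ?powR_ge0// powR_double.
apply: (@le_trans _ _ (sobolev_weight p w k * (knorm k `^ p * cnorm (mode (k - l) l)))).
  have h := normc_dot (conjv (mode (k - l) l)) (vcoef w k).
  rewrite cnorm_conjv in h.
  apply: le_trans (ler_wpM2l _ h) _; first by rewrite mulr_ge0 ?powR_ge0.
  by rewrite /sobolev_weight le_eqVlt; apply/orP; left; apply/eqP; ring.
by rewrite ler_wpM2l ?sobolev_weight_ge0// cnorm_mode.
Qed.

Lemma wp_sum : sum_le (fun k => sobolev_weight p w k ^+ 2) (Hnorm p w ^+ 2).
Proof. by apply: (Hspace_sum_le hw); rewrite lerDl. Qed.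

(** The double series is absolutely summable by Young's inequality, so it may
    be summed over pairs. *)
Lemma has_sum_inner_NSmap :
  has_sum (fun kl : 'rV[int]_d * 'rV[int]_d => inner_summand kl.1 kl.2)
    (inner p (NSmap v w) w).
Proof.
have [_ cNS] := NSmap_spec.
pose g k := (knorm k `^ (2 * p))%:C * dot (conjv (u k)) (vcoef w k).
have innerE : inner p (NSmap v w) w = csum Z0 g.
  congr csum; apply/funext => k; rewrite /g cNS dot_conjv_leray//.
have hg : has_sum g (inner p (NSmap v w) w).
  have [B B0 hB] := weighted_advection_l2.
  rewrite innerE; apply: (@has_sum_csum _ _ _ _ (Hnorm p w * B)) => [k k0|K].
    have -> : k = 0 by apply: contrapT.
    by rewrite /g mean_w dot0r mulr0.
  apply: (@le_trans _ _ (\sum_(k <- K) sobolev_weight p w k * (knorm k `^ p * cnorm (u k)))).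
    apply: ler_sum => k _; rewrite ComplexField.Normc.normcM normcR ger0_norm ?powR_ge0//.
    have h := normc_dot (conjv (u k)) (vcoef w k); rewrite cnorm_conjv in h.
    rewrite powR_double.
    apply: le_trans (ler_wpM2l _ h) _; first by rewrite mulr_ge0 ?powR_ge0.
    by rewrite /sobolev_weight le_eqVlt; apply/orP; left; apply/eqP; ring.
  by apply: cauchy_schwarz_sqrt; [exact: Hnorm_ge0|exact: B0|exact: wp_sum|exact: hB].
have hrow k : has_sum (fun l => inner_summand k l) (g k).
  apply: has_sumZ; apply: has_sum_big => s; apply: has_sumZr.
  rewrite !mxE; under eq_fun do rewrite mxE.
  by apply: has_sum_conj; have := has_sum_modes k s; rewrite mxE.
have [B B0 hB] := interaction_young d0 p0 dp hv hw.
have hs : has_sum (fun kl : 'rV[int]_d * 'rV[int]_d => inner_summand kl.1 kl.2)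
    (csum setT (fun kl : 'rV[int]_d * 'rV[int]_d => inner_summand kl.1 kl.2)).
  apply: (@has_sum_csum _ _ _ _ (Hnorm p w * B)) => [k []//|F].
  pose K := [fset x.1 | x in F]%fset; pose L := [fset x.2 | x in F]%fset.
  apply: (@le_trans _ _ (\sum_(x <- (K `*` L)%fset) normc (inner_summand x.1 x.2))).
    apply: fsum_le_subset => [x|]; first exact: normc_ge0.
    apply/fsubsetP => x xF; rewrite in_fsetM; apply/andP; split.
      by apply/imfsetP; exists x.
    by apply/imfsetP; exists x.
  rewrite fsetM_sum/=.
  apply: (@le_trans _ _ (\sum_(k <- K) sobolev_weight p w k * \sum_(l <- L) inter k l)).
    apply: ler_sum => k _; rewrite mulr_sumr; apply: ler_sum => l _.
    exact: normc_inner_summand.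
  by apply: cauchy_schwarz_sqrt; [exact: Hnorm_ge0|exact: B0|exact: wp_sum|exact: hB].
by rewrite (has_sum_unique hg (has_sum_pair hs hrow)).
Qed.

End NavierStokesProduct.

(** * The Kato inequality *)

Section KatoInequality.
Context {R : realType} {d : nat}.
Local Notation knorm := (@knorm R d).
Local Notation kappa := (@basis_scale R d).
Implicit Types (k h l : 'rV[int]_d).
Variables (p n : R) (v w : vfunctional R d).
Hypotheses (d0 : (0 < d)%N) (hpn : n <= p) (hn : d%:R / 2 + 1 < n).
Hypotheses (hv : Hspace p v) (hw : Hspace (p + 1) w).
Local Notation mode := (mode_product v w).

Let n1 : 1 < n.
Proof. by apply: le_lt_trans hn; rewrite lerDr divr_ge0. Qed.

Let p1 : 1 < p. Proof. exact: lt_le_trans hpn. Qed.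

Let dp : d%:R < 2 * p.
Proof.
have h1 := hn; have h2 := hpn; have := ler0n R d.
by move: (d%:R : R) h1 h2 => D h1 h2 D0; lra.
Qed.

Let dw : is_vdistribution w. Proof. by case: hw. Qed.
Let divv k : dot (cvec k) (vcoef v k) = 0. Proof. by case: hv. Qed.
Let divw k : dot (cvec k) (vcoef w k) = 0. Proof. by case: hw. Qed.
Let mean_v : vcoef v 0 = 0. Proof. by case: hv. Qed.
Let mean_w : vcoef w 0 = 0. Proof. by case: hw. Qed.

Lemma fsum_opp (V : nmodType) (S : {fset 'rV[int]_d}) (f : 'rV[int]_d -> V) :
  (forall k, k \in S -> - k \in S) -> \sum_(k <- S) f k = \sum_(k <- S) f (- k).
Proof.
move=> hS; have {1}-> : S = [fset - k | k in S]%fset.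
  apply/fsetP => k; apply/idP/imfsetP => [kS|[l lS ->]]; last exact: hS.
  by exists (- k); rewrite ?opprK//=; exact: hS.
by rewrite big_imfset//= => k l _ _; exact: oppr_inj.
Qed.

(** The summand of <P(v, |D|^p w) | |D|^p w>. *)
Definition transport k l : R[i] :=
  (knorm k `^ p * knorm l `^ p)%:C * dot (conjv (mode (k - l) l)) (vcoef w k).

(** Transport by a divergence-free real field is skew-adjoint. On the Fourier
    side, (k, l) -> (-l, -k) keeps the wave vector k - l of the field, and
    v_(k-l).k = v_(k-l).l because v_(k-l) is orthogonal to k - l. *)
Lemma transport_antisym k l : transport (- l) (- k) = - transport k l.
Proof.
rewrite /transport !knormN [knorm l `^ p * _]mulrC opprK [- l + k]addrC.
rewrite -mulrN; congr (_ * _).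
rewrite /mode_product !(vcoefN _ dw) cvecN dotNr.
have -> : dot (vcoef v (k - l)) (cvec k) = dot (vcoef v (k - l)) (cvec l).
  have := divv (k - l); rewrite cvecB dotDl dotNl dotC [dot (cvec l) _]dotC.
  by move/eqP; rewrite subr_eq0 => /eqP.
rewrite !conjvZ conjvK !dotZl [dot (vcoef w k) _]dotC.
have ci : conjc 'i%C = - 'i%C :> R[i].
  by apply/eqP; rewrite eq_complex/= oppr0 !eqxx.
by rewrite !conjcM conjcN ci conjc_real; ring.
Qed.

Lemma sum_transport (S : {fset 'rV[int]_d}) : (forall k, k \in S -> - k \in S) ->
  \sum_(k <- S) \sum_(l <- S) transport k l = 0.
Proof.
move=> hS; set T := \sum_(k <- S) _.
have row k : \sum_(i <- S) transport i (- k) = - \sum_(l <- S) transport k l.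
  apply: etrans (fsum_opp (fun i => transport i (- k)) hS) _; rewrite -sumrN.
  by apply: eq_bigr => l _; exact: transport_antisym.
have : T == - T.
  apply/eqP; rewrite {1}/T exchange_big/=.
  apply: etrans (fsum_opp (fun j => \sum_(i <- S) transport i j) hS) _.
  by rewrite -sumrN; apply: eq_bigr => k _; exact: row.
by rewrite -subr_eq0 opprK -mulr2n mulrn_eq0/= => /eqP.
Qed.

(** The quotient whose squares are summed in G_pn, in terms of l = k - h. *)
Definition Gquotient k l : R :=
  `|knorm k `^ p - knorm l `^ p| * Pnorm (k - l) l / Gdenominator p n (k - l) l.

Lemma Gquotient_sqr k l : Gquotient k l ^+ 2 = Gterm p n k (k - l).
Proof.
by rewrite /Gquotient /Gterm subKr !exprMn exprVn real_normK ?num_real.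
Qed.

(** The denominator of [Gquotient] times |l| |v_(k-l)| |w_l|, written as a sum of
    two products of square summable weights. *)
Definition Nproduct k l : R :=
  sobolev_weight p v (k - l) * sobolev_weight n w l +
  sobolev_weight n v (k - l) * sobolev_weight p w l.

Lemma NproductE k l : Nproduct k l =
  Gdenominator p n (k - l) l * (knorm l * cnorm (vcoef v (k - l)) * cnorm (vcoef w l)).
Proof.
rewrite /Nproduct /Gdenominator /sobolev_weight.
have n0 : 0 < n by exact: lt_trans n1.
have p0 : 0 < p by exact: lt_trans p1.
move: (mulr_powRB1 (knorm_ge0 (R := R) l) n0) (mulr_powRB1 (knorm_ge0 (R := R) l) p0).
move: (knorm l `^ (n - 1)) (knorm l `^ (p - 1)) (knorm l `^ n) (knorm l `^ p).
by move=> a b A B <- <-; ring.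
Qed.

Lemma Gquotient_product k l :
  `|knorm k `^ p - knorm l `^ p| * Pnorm (k - l) l *
    (knorm l * cnorm (vcoef v (k - l)) * cnorm (vcoef w l)) =
  Gquotient k l * Nproduct k l.
Proof.
have z m (f : vfunctional R d) : vcoef f 0 = 0 -> sobolev_weight m f 0 = 0.
  by rewrite /sobolev_weight => ->; rewrite cnorm0 mulr0.
have [h0|h0] := eqVneq (k - l) 0.
  have -> : Nproduct k l = 0 by rewrite /Nproduct h0 !(z _ _ mean_v) !mul0r addr0.
  have -> : cnorm (vcoef v (k - l)) = 0 by rewrite h0 mean_v cnorm0.
  by rewrite mulr0 mul0r !mulr0.
have [l00|l0] := eqVneq l 0.
  have -> : Nproduct k l = 0 by rewrite /Nproduct l00 !(z _ _ mean_w) !mulr0 addr0.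
  have -> : cnorm (vcoef w l) = 0 by rewrite l00 mean_w cnorm0.
  by rewrite !mulr0.
have D0 : Gdenominator p n (k - l) l != 0.
  by rewrite gt_eqF// addr_gt0// mulr_gt0// powR_gt0// knorm_gt0.
by rewrite NproductE /Gquotient mulrA divfK.
Qed.

Lemma leray_mode k l : leray_symbol k (mode (k - l) l) =
  (kappa%:C * 'i%C * (knorm l)%:C) *: Pmap (k - l) l (vcoef v (k - l)) (vcoef w l).
Proof.
rewrite /mode_product /Pmap leray_symbolZ subrK scalerA; congr (_ *: _).
rewrite -!mulrA; congr (_ * (_ * _)).
have [->|l0] := eqVneq l 0; first by rewrite cvec0 dot0r knorm0 !mul0r.
rewrite mulrC divfK// -[0]/(0%:C) (inj_eq (@complexI _)).
by rewrite gt_eqF// knorm_gt0.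
Qed.

(** The difference is the contribution of the commutator of |D|^p with the
    advection by [v]. *)
Lemma commutator_le k l : normc (inner_summand p v w k l - transport k l) <=
  kappa * (sobolev_weight p w k * Gquotient k l * Nproduct k l).
Proof.
rewrite -mulrA -Gquotient_product /inner_summand /transport -mulrBl.
rewrite -rmorphB powR_double -mulrBr ComplexField.Normc.normcM normcR normrM.
rewrite (ger0_norm (powR_ge0 _ _)) -(dot_conjv_leray _ (divw k)).
have := normc_dot (conjv (leray_symbol k (mode (k - l) l))) (vcoef w k).
rewrite cnorm_conjv leray_mode cnormZ !ComplexField.Normc.normcM normc_i normc_basis_scale.
rewrite normcR (ger0_norm (knorm_ge0 l)).
have := cnorm_Pmap (divv (k - l)) (divw l).
rewrite /sobolev_weight; move: (normc (dot _ _)) => y.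
move: (basis_scale_gt0 (R := R) (d := d)) (knorm_ge0 (R := R) l) (cnorm_ge0 (vcoef w k))
  (powR_ge0 (knorm k) p) (normr_ge0 (knorm k `^ p - knorm l `^ p)).
move: (cnorm (Pmap _ _ _ _)) (Pnorm _ _) (cnorm (vcoef v _))
  (cnorm (vcoef w l)) (cnorm (vcoef w k)) (knorm l) (knorm k `^ p)
  `|knorm k `^ p - knorm l `^ p| kappa
  => M P a b c L K N s s0 L0 c0 K0 N0 hM hy.
have h : y <= s * 1 * L * (P * a * b) * c.
  by apply: (le_trans hy); rewrite ler_wpM2r// ler_wpM2l// mulr1 mulr_ge0// ltW.
apply: (@le_trans _ _ (K * N * (s * 1 * L * (P * a * b) * c))).
  by apply: ler_wpM2l h; exact: mulr_ge0.
by rewrite le_eqVlt; apply/orP; left; apply/eqP; ring.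
Qed.

Hypothesis supy : (supG d p n < +oo)%E.

Lemma fine_supG_ge0 : 0 <= fine (supG d p n : \bar R).
Proof.
have k0 : (const_mx 1 : 'rV[int]_d) != 0.
  by apply/eqP => /rowP/(_ (Ordinal d0)); rewrite !mxE.
by rewrite fine_ge0// (le_trans (Gcal_ge0 p n (const_mx 1 : 'rV[int]_d)))// supG_ge.
Qed.

Lemma Gquotient_weighted_l2 (K L : {fset 'rV[int]_d}) :
  \sum_(kl <- (K `*` L)%fset) (sobolev_weight p w kl.1 * Gquotient kl.1 kl.2) ^+ 2 <=
  (Num.sqrt (fine (supG d p n)) / 2 * Hnorm p w) ^+ 2.
Proof.
rewrite fsetM_sum/= !exprMn sqr_sqrtr ?fine_supG_ge0// exprVn -natrX.
apply: (@le_trans _ _ (\sum_(k <- K) fine (supG d p n) / 4 * sobolev_weight p w k ^+ 2)).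
  apply: ler_sum => k _.
  under eq_bigr do rewrite exprMn Gquotient_sqr.
  rewrite -mulr_sumr mulrC.
  have [->|k0] := eqVneq k 0.
    by rewrite /sobolev_weight mean_w cnorm0 mulr0 expr0n/= !mulr0.
  apply: ler_wpM2r; first exact: sqr_ge0.
  have inj : injective (fun l : 'rV[int]_d => k - l) by move=> a b /addrI/oppr_inj.
  exact: (sum_le_inj inj (Gterm_sum_supG n1 hpn supy k0)).
rewrite -mulr_sumr; apply: ler_wpM2l; first by rewrite divr_ge0// fine_supG_ge0.
by apply: (Hspace_sum_le hw); rewrite lerDl.
Qed.

Lemma Nproduct_l2 (K L : {fset 'rV[int]_d}) :
  \sum_(kl <- (K `*` L)%fset) Nproduct kl.1 kl.2 ^+ 2 <=
  (Hnorm p v * Hnorm n w + Hnorm n v * Hnorm p w) ^+ 2.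
Proof.
have np1 : n <= p + 1 by rewrite (le_trans hpn)// lerDl.
have pp1 : p <= p + 1 by rewrite lerDl.
have inj : injective (fun kl : 'rV[int]_d * 'rV[int]_d => (kl.1 - kl.2, kl.2)).
  by move=> [k l] [k' l'] /= [e el]; rewrite -(subrK l k) e el subrK.
have prod (m m' : R) : m <= p -> m' <= p + 1 ->
    \sum_(kl <- (K `*` L)%fset)
      (sobolev_weight m v (kl.1 - kl.2) * sobolev_weight m' w kl.2) ^+ 2 <=
    (Hnorm m v * Hnorm m' w) ^+ 2.
  move=> hm hm'; rewrite exprMn; under eq_bigr do rewrite exprMn.
  exact: (sum_le_inj inj (sum_le_prod (fun k => sqr_ge0 (sobolev_weight m v k))
    (fun k => sqr_ge0 (sobolev_weight m' w k)) (Hspace_sum_le hv hm) (Hspace_sum_le hw hm'))).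
apply: minkowski_seq; rewrite ?mulr_ge0 ?Hnorm_ge0//; exact: prod.
Qed.

(** On a finite symmetric square of modes the transport terms cancel exactly,
    so they can be subtracted before the limit is taken; one Cauchy-Schwarz
    inequality over the pairs (k, l) then separates G_pn from the norms. *)
Lemma kato_inequality : kato_bound p n (Gplus d p n) v w.
Proof.
rewrite /kato_bound /Gplus -/(basis_scale).
have p0 : 0 <= p by rewrite ltW// (lt_trans ltr01).
apply: has_sum_normc_le (has_sum_inner_NSmap d0 p0 dp hv hw) _ => F0.
pose S0 := ([fset x.1 | x in F0] `|` [fset x.2 | x in F0])%fset.
pose S := (S0 `|` [fset - k | k in S0])%fset.
have SN k : k \in S -> - k \in S.
  move=> /fsetUP[kS|/imfsetP[l /= lS ->]]; apply/fsetUP; last by left; rewrite opprK.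
  by right; apply/imfsetP; exists k.
exists (S `*` S)%fset.
  apply/fsubsetP => x xF; rewrite in_fsetM.
  apply/andP; split; apply/fsetUP; left; apply/fsetUP; [left|right];
    by apply/imfsetP; exists x.
have -> : \sum_(x <- (S `*` S)%fset) inner_summand p v w x.1 x.2 =
    \sum_(x <- (S `*` S)%fset) (inner_summand p v w x.1 x.2 - transport x.1 x.2).
  by rewrite sumrB [X in _ - X]fsetM_sum/= sum_transport// subr0.
apply: le_trans (normc_sum _ _ _) _.
apply: le_trans (ler_sum _ (fun x _ => commutator_le x.1 x.2)) _.
rewrite -mulr_sumr.
have Y0 : 0 <= Hnorm p v * Hnorm n w + Hnorm n v * Hnorm p w.
  by rewrite addr_ge0// mulr_ge0 ?Hnorm_ge0.
have X0 : 0 <= Num.sqrt (fine (supG d p n)) / 2 * Hnorm p w.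
  by rewrite mulr_ge0 ?Hnorm_ge0// divr_ge0 ?sqrtr_ge0.
have := cauchy_schwarz_sqrt X0 Y0 (Gquotient_weighted_l2 S S) (Nproduct_l2 S S).
move/(ler_wpM2l (ltW (basis_scale_gt0 (R := R) (d := d)))) => h.
have E (a q W Y : R) : a * (q / 2 * W * Y) = 2^-1 * (a * q) * Y * W by ring.
by apply: (le_trans h); rewrite E.
Qed.

End KatoInequality.

(** The defining inequalities of a constant are closed conditions, so the
    infimum of all constants satisfies them. *)
Lemma smallest_kato_constant (R : realType) (d : nat) (p n G0 : R) :
  kato_constant d p n G0 ->
  exists G, [/\ kato_constant d p n G,
    (forall G', kato_constant d p n G' -> G <= G') & G <= G0].
Proof.
move=> hG0; pose A := [set G : R | kato_constant d p n G].
have lbA : lbound A 0 by move=> G [].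
have A0 : A !=set0 by exists G0.
have infP G' : kato_constant d p n G' -> inf A <= G'.
  by move=> h; apply: ge_inf => //; exists 0.
exists (inf A); split => //; last exact: infP.
split => [|v w hv hw]; first exact: (lb_le_inf A0 lbA).
rewrite /kato_bound.
have c0 : 0 <= (Hnorm p v * Hnorm n w + Hnorm n v * Hnorm p w) * Hnorm p w.
  by rewrite mulr_ge0 ?Hnorm_ge0// addr_ge0// mulr_ge0 ?Hnorm_ge0.
have E (G a W : R) : 2^-1 * G * a * W = G * (2^-1 * (a * W)) by ring.
have bound G : kato_constant d p n G -> ComplexField.Normc.normc (inner p (NSmap v w) w) <=
    G * (2^-1 * ((Hnorm p v * Hnorm n w + Hnorm n v * Hnorm p w) * Hnorm p w)).
  by move=> [_ /(_ v w hv hw)]; rewrite /kato_bound E.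
rewrite E; move: c0 bound; set c := _ * Hnorm p w; rewrite le_eqVlt.
move=> /predU1P[<-|c0] bound; first by have := bound _ hG0; rewrite !mulr0.
have c1 : 0 < 2^-1 * c by rewrite mulr_gt0// invr_gt0.
rewrite -(ler_pdivrMr _ _ c1); apply: (lb_le_inf A0) => G hG.
by rewrite (ler_pdivrMr _ _ c1); exact: bound.
Qed.

Theorem theorem4p4 (R : realType) (d : nat) (p n : R)
    (hd : (2 <= d)%N) (hpn : n <= p) (hn : d%:R / 2 + 1 < n) :
  [/\ (supG d p n < +oo)%E,
      (forall v w : vfunctional R d, Hspace p v -> Hspace (p + 1) w ->
         Hspace p (NSmap v w) /\ kato_bound p n (Gplus d p n) v w) &
      exists G : R,
        [/\ kato_constant d p n G,
            (forall G' : R, kato_constant d p n G' -> G <= G') &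
            G <= Gplus d p n]].
Proof.
have d0 : (0 < d)%N by exact: leq_trans hd.
have D0 := ler0n R d.
have n1 : 1 < n by apply: le_lt_trans hn; rewrite lerDr divr_ge0.
have p0 : 0 <= p by rewrite (le_trans _ hpn)// ltW// (lt_trans _ n1).
have dp : d%:R < 2 * p.
  by move: (d%:R : R) hn D0 => D hn D0; lra.
have supy := supG_lty n1 hpn d0 hn.
have bound (v w : vfunctional R d) : Hspace p v -> Hspace (p + 1) w -> kato_bound p n (Gplus d p n) v w.
  by move=> hv hw; exact: (kato_inequality d0 hpn hn hv hw supy).
split => // [v w hv hw|]; first by split; [exact: (NSmap_Hspace d0 p0 dp hv hw)|exact: bound].
apply: smallest_kato_constant; split => // .
by rewrite mulr_ge0 ?sqrtr_ge0// invr_ge0 powR_ge0.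
Qed.
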